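(* Let $n\ge1$, $1\le M\le n$, and let $\underline{s}\in\mathbb{R}^n$ with $s_i>\frac12$ for $i\neq M$ and $s_M>0$. Let $y\in P_{A_n}$ and let $X$ be a $Q_{A_n}$-valued random variable with the Wishart law $\gamma^{(M)}_{\underline{s},y}$. Let $N\ge1$ and $z^{(1)},\dots,z^{(N)}\in Z_G$, $G=A_n$. Then, denoting by $S_N$ the symmetric group and by $C(\pi)$ the set of cycles of a permutation $\pi\in S_N$, $$\mathbf{E}\bigl(\langle X,z^{(1)}\rangle\cdots\langle X,z^{(N)}\rangle\bigr)=\sum_{\pi\in S_N}\prod_{c\in C(\pi)}\Bigl\{\sum_{i=1}^{M-1}(s_i-s_{i+1})\,\mathrm{tr}\prod_{j\in c}(y_{\{1:i\}})^{-1}z^{(j)}_{\{1:i\}}+s_M\,\mathrm{tr}\prod_{j\in c}y^{-1}z^{(j)}+\sum_{i=M+1}^{n}(s_i-s_{i-1})\,\mathrm{tr}\prod_{j\in c}(y_{\{i:n\}})^{-1}z^{(j)}_{\{i:n\}}\Bigr\}.$$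
   Context: $G=A_n$ is the path graph $1-2-\cdots-n$ on $V=\{1,\dots,n\}$; $E=\{(i,j): |i-j|\le 1\}$. $Z_G$ is the space of real symmetric $n\times n$ matrices $y$ with $y_{ij}=0$ if $(i,j)\notin E$; $P_{A_n}=P_G$ is the set of positive definite $y\in Z_G$. $I_G$ is the dual space of $Z_G$, realised as the space of incomplete symmetric matrices $\eta=(\eta_{ij})_{(i,j)\in E}$, with $\langle y,\eta\rangle=\langle\eta,y\rangle=\mathrm{tr}(y\eta)=\sum_{(i,j)\in E}y_{ij}\eta_{ij}$. $Q_{A_n}=Q_G=\{\eta\in I_G:\langle y,\eta\rangle>0\ \forall y\in\overline{P_G}\setminus\{0\}\}$. $d\eta$ is Lebesgue measure on $I_G$. For $I\subset V$, a subscript $I$ denotes the submatrix with rows and columns in $I$; $\{i:j\}=\{i,\dots,j\}$; $|\cdot|$ is the determinant. With $s_0=s_{n+1}=0$, for $\eta\in Q_G$, $$\delta^{(M)}_{\underline{s}}(\eta)=\frac{\prod_{i=1}^{M-1}|\eta_{\{i:i+1\}}|^{s_i}\prod_{i=M+1}^{n}|\eta_{\{i-1:i\}}|^{s_i}}{\prod_{i=2}^{M-1}\eta_{ii}^{s_{i-1}}\cdot\eta_{MM}^{s_{M-1}-s_M+s_{M+1}}\cdot\prod_{i=M+1}^{n-1}\eta_{ii}^{s_{i+1}}};$$ $\varphi_{A_1}(\eta)=\eta^{-1}$, and for $n\ge2$, $\varphi_{A_n}(\eta)=\prod_{i=1}^{n-1}|\eta_{\{i,i+1\}}|^{-3/2}\prod_{i=2}^{n-1}\eta_{ii}$.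 The Wishart law $\gamma^{(M)}_{\underline{s},y}$ is the probability measure on $Q_G$ with density proportional to $e^{-\mathrm{tr}(y\eta)}\delta^{(M)}_{\underline{s}}(\eta)\varphi_{A_n}(\eta)$ with respect to $d\eta$. Cycles include fixed points (cycles of length one). For a cycle $c=(j_1\,j_2\cdots j_k)$ the product $\prod_{j\in c}B_j$ of matrices means $B_{j_1}B_{j_2}\cdots B_{j_k}$, in the cyclic order of $c$ (its trace does not depend on the starting point). *)

(* Defs.v *)
From HB Require Import structures.
From mathcomp Require Import all_boot all_order all_algebra all_fingroup.
From mathcomp Require Import all_classical all_reals all_analysis.

Set Implicit Arguments.
Unset Strict Implicit.
Unset Printing Implicit Defensive.

Import Order.TTheory GRing.Theory Num.Theory.
Import numFieldNormedType.Exports.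

Local Open Scope classical_set_scope.
Local Open Scope ring_scope.

(* [lebesgue_tuple k] is the Lebesgue measure on
   [k.-tuple R], obtained by iterating the product measure. The sigma-algebra
   of [measurableTypeR R] is the Borel sigma-algebra of [R]; only its display
   differs from that of the default measurable structure on [R]. *)
Section lebesgue_tuple.
Context {R : realType}.
Local Open Scope ereal_scope.

Definition tuple_cons (k : nat) (p : measurableTypeR R * k.-tuple R) :
  k.+1.-tuple R := [tuple of (p.1 : R) :: p.2].

Lemma measurable_tuple_cons (k : nat) :
  measurable_fun setT (@tuple_cons k).
Proof.
apply: (@measurable_cons _ _ (measurableTypeR R * k.-tuple R)%type R
  (fun p => p.1 : R) k snd) => //.
exact: (@measurable_fst _ _ (measurableTypeR R)).
Qed.

Section step.
Variables (k : nat) (m : {sigma_finite_measure set (k.-tuple R) -> \bar R}).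

Definition lebesgue_cons : set (k.+1.-tuple R) -> \bar R :=
  pushforward (lebesgue_measure \x m) (@tuple_cons k).

Let lebesgue_cons0 : lebesgue_cons set0 = 0.
Proof. by rewrite /lebesgue_cons /pushforward preimage_set0 measure0. Qed.

Let lebesgue_cons_ge0 A : 0 <= lebesgue_cons A.
Proof. by rewrite /lebesgue_cons /pushforward; exact: measure_ge0. Qed.

Let lebesgue_cons_sigma_additive : semi_sigma_additive lebesgue_cons.
Proof.
move=> F mF tF mUF; rewrite /lebesgue_cons /pushforward preimage_bigcup.
have mp A : measurable A -> measurable (@tuple_cons k @^-1` A).
  by move=> mA; rewrite -[X in measurable X]setTI; exact: measurable_tuple_cons.
apply: measure_semi_sigma_additive.
- by move=> n; exact: mp.
- apply/trivIsetP => /= i j _ _ ij; rewrite -preimage_setI.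
  by move/trivIsetP : tF => /(_ _ _ _ _ ij) ->//; rewrite preimage_set0.
- by rewrite -preimage_bigcup; exact: mp.
Qed.

HB.instance Definition _ := isMeasure.Build _ _ _ lebesgue_cons
  lebesgue_cons0 lebesgue_cons_ge0 lebesgue_cons_sigma_additive.

(* The sigma-finiteness instance of [\x] in the library only fires for
   subprobabilities. *)
Let prod_sigma_finite : sigma_finite setT (lebesgue_measure \x m).
Proof.
have /sigma_finiteP[F [TF ndF Foo]] := sigma_finiteT (@lebesgue_measure R).
have /sigma_finiteP[G [TG ndG Goo]] := sigma_finiteT m.
exists (fun n => F n `*` G n).
  rewrite -setXTT TF TG predeqE => -[x y]; split.
    move=> [/= [n _ Fnx] [l _ Gly]]; exists (maxn n l) => //; split.
    - by move: x Fnx; exact/subsetPset/ndF/leq_maxl.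
    - by move: y Gly; exact/subsetPset/ndG/leq_maxr.
  by move=> [n _ []/= ? ?]; split; exists n.
move=> l; have [? ?] := Foo l; have [? ?] := Goo l.
split; first exact: measurableX.
by rewrite product_measure1E// lte_mul_pinfty// ge0_fin_numE.
Qed.

Let lebesgue_cons_sigma_finite : sigma_finite setT lebesgue_cons.
Proof.
have [F TF Foo] := prod_sigma_finite.
pose unc (t : k.+1.-tuple R) : measurableTypeR R * k.-tuple R :=
  (thead t, [tuple of behead t]).
have uncK t : tuple_cons (unc t) = t.
  by apply/val_inj; rewrite /= [in RHS](tuple_eta t).
have consK p : unc (tuple_cons p) = p.
  by case: p => a t; congr pair; apply/val_inj.
have munc : measurable_fun setT unc.
  apply/measurable_fun_pairP; split; last exact: measurable_behead.
  exact: (@measurable_tnth _ R k.+1 ord0).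
exists (fun n => unc @^-1` F n).
  by rewrite -preimage_bigcup -TF preimage_setT.
move=> n; have [mFn Fnoo] := Foo n; split.
  by rewrite -[X in measurable X]setTI; exact: munc.
rewrite /lebesgue_cons /pushforward (_ : _ @^-1` _ = F n)//.
by apply/seteqP; split=> p /=; rewrite consK.
Qed.

HB.instance Definition _ := Measure_isSigmaFinite.Build _ _ _ lebesgue_cons
  lebesgue_cons_sigma_finite.

End step.

Fixpoint lebesgue_tuple (k : nat) :
    {sigma_finite_measure set (k.-tuple R) -> \bar R} :=
  if k is k'.+1 then lebesgue_cons (lebesgue_tuple k')
  else \d_([tuple] : 0.-tuple R).

End lebesgue_tuple.

(* The path graph 1 - 2 - ... - n. Vertices, and the indices of the parameter
   s, are numbered from 1 as in the formulas below: [v : 'I_n] stands for the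
   vertex [v.+1]. *)
Section path_graph.
Context {R : realType} {n : nat}.
Implicit Types (y z : 'M[R]_n) (s : 'I_n -> R).

(* Reads u_k for k = 1, ..., n, and is 0 elsewhere, so that
   s_0 = s_{n+1} = 0. *)
Definition vcoord (u : 'I_n -> R) (k : nat) : R :=
  if k is k'.+1 then
    if insub k' : option 'I_n is Some i then u i else 0
  else 0.

(* The set of vertices {a : b}. *)
Definition vint (a b : nat) : {set 'I_n} :=
  [set v : 'I_n | (a <= v.+1 <= b)%N]%SET.

(* The submatrix with rows and columns in I, in increasing order. *)
Definition psubmx (I : {set 'I_n}) (A : 'M[R]_n) : 'M[R]_#|I| :=
  mxsub (@enum_val _ (mem I)) (@enum_val _ (mem I)) A.

(* (i, j) is in E iff |i - j| <= 1. *)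
Definition edge (i j : 'I_n) : bool := (i <= j.+1)%N && (j <= i.+1)%N.

Definition ZG : set 'M[R]_n :=
  [set y | y^T = y /\ forall i j, ~~ edge i j -> y i j = 0].

Definition PG : set 'M[R]_n :=
  [set y | ZG y /\
    forall v : 'cV[R]_n, v != 0 -> 0 < (v^T *m y *m v) ord0 ord0].

(* An incomplete symmetric matrix eta = (eta_ij)_{(i,j) in E} is given by its
   n diagonal entries and its n - 1 entries eta_{i,i+1}. *)
Definition IG : Type := (n.-tuple R * (n.-1).-tuple R)%type.

HB.instance Definition _ := Measurable.on IG.

(* The entries of eta on E; those outside E do not exist and are filled in
   with the dummy value 0, which is never read below. *)
Definition inc_mx (eta : IG) : 'M[R]_n :=
  \matrix_(i, j) if i == j then tnth eta.1 i
                 else if edge i j then nth 0 eta.2 (minn i j) else 0.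

Definition lebesgueI : set IG -> \bar R :=
  (lebesgue_tuple n \x lebesgue_tuple n.-1)%E.

HB.instance Definition _ := Measure.on lebesgueI.

Definition pairing (eta : IG) (y : 'M[R]_n) : R :=
  \sum_(i < n) \sum_(j < n | edge i j) y i j * inc_mx eta i j.

Definition QG : set IG :=
  [set eta | forall y, closure PG y -> y != 0 -> 0 < pairing eta y].

(* eta_{ii} and |eta_{i : i+1}|, for vertices i. *)
Definition idiag (eta : IG) (i : nat) : R :=
  vcoord (fun v => inc_mx eta v v) i.

Definition iminor (eta : IG) (i : nat) : R :=
  \det (psubmx (vint i i.+1) (inc_mx eta)).

Definition delta (M : nat) s (eta : IG) : R :=
  (\prod_(1 <= i < M) iminor eta i `^ vcoord s i *
   \prod_(M.+1 <= i < n.+1) iminor eta i.-1 `^ vcoord s i) /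
  (\prod_(2 <= i < M) idiag eta i `^ vcoord s i.-1 *
   idiag eta M `^ (vcoord s M.-1 - vcoord s M + vcoord s M.+1) *
   \prod_(M.+1 <= i < n) idiag eta i `^ vcoord s i.+1).

Definition phi (eta : IG) : R :=
  if n == 1%N then (idiag eta 1)^-1
  else \prod_(1 <= i < n) iminor eta i `^ (- (3 / 2)) *
       \prod_(2 <= i < n) idiag eta i.

Definition wishart_fun (M : nat) s y (eta : IG) : R :=
  expR (- pairing eta y) * delta M s eta * phi eta.

(* The law on Q_G with density proportional to [wishart_fun M s y]. *)
Definition wishart (M : nat) s y (A : set IG) : \bar R :=
  (((fine (\int[lebesgueI]_(eta in QG) (wishart_fun M s y eta)%:E))^-1)%:E *
   \int[lebesgueI]_(eta in A `&` QG) (wishart_fun M s y eta)%:E)%E.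

End path_graph.

Arguments IG : clear implicits.

(* The cycle c of p, listed as x, p x, p (p x), ... from some x in c. *)
Definition cycle_seq (N : nat) (p : 'S_N) (c : {set 'I_N}) : seq 'I_N :=
  if [pick x in c] is Some x then traject p x #|c| else [::].

Definition tr_cycle (R : realType) (N m : nat) (p : 'S_N) (c : {set 'I_N})
    (B : 'I_N -> 'M[R]_m) : R :=
  \tr (\prod_(j <- cycle_seq p c) B j).

(* Main.v *)
From HB Require Import structures.
Require Import Defs.
From mathcomp Require Import all_boot all_order all_algebra all_fingroup.
From mathcomp Require Import all_classical all_reals all_analysis.
From mathcomp Require Import measurable_realfun.
From mathcomp Require Import ring lra zify.

Set Implicit Arguments.
Unset Strict Implicit.
Unset Printing Implicit Defensive.

Import Order.TTheory GRing.Theory Num.Theory.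
Import numFieldNormedType.Exports.

Local Open Scope classical_set_scope.
Local Open Scope ring_scope.

(** The moments are the derivatives of the Laplace transform of the law, and this
    transform is an explicit product of powers of minors of y.

    Laplace transform. In the coordinates eta_ii and eta_{i,i+1} the cone Q_G is
    given by the positivity of the 1 x 1 and of the consecutive 2 x 2 minors
    (QG_in_dual_cone). Hence exp(- tr(y eta)) delta phi, cut off to Q_G, is a product
    of one factor for each vertex and one for each edge of the path, and it can be
    integrated by eliminating the vertices one at a time, from both ends towards M.
    Eliminating an end vertex with pivot d and off-diagonal entry b costs one
    Gamma integral and one Gaussian integral (integral_edge_kernel): it gives d^(- s),
    cancels the power of the neighbouring entry and replaces the diagonal entry of y
    at the neighbour by its Schur complement. The pivots that appear are quotients of
    consecutive minors of y, so the result (path_laplace) is a constant times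
      prod_{i < M} |y_{1:i}|^(s_{i+1} - s_i) . |y|^(- s_M)
        . prod_{i > M} |y_{i:n}|^(s_{i-1} - s_i).
    The constant is carried along as an element of [0, +oo]; it is finite and positive
    since the law has total mass one, and it cancels in
      E exp(- <X, y' - y>) = exp (l(y) - l(y')),  y' in P_G,
    where exp (- l) is the product above (wishart_laplace_transform).

    Moments. Differentiating under the expectation, one matrix z^(j) at a time, gives
    E (<X, z^(1)> ... <X, z^(N)> exp(- <X, y' - y>)) for all y' in P_G
    (moment_formula). Domination comes for free from the geometry of the cone: for
    y in P_G and z in Z_G some multiple c y dominates both z and - z (PG_absorbs), so
    that |<X, z>| <= c <X, y>, and polynomials in <X, y> are absorbed by moving y a
    little inside P_G.

    Permutations. Write T(c) for the expression in braces. Derivation in the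
    direction z sends l to T((z)), by Jacobi's formula for log det, and sends T(c) to
    minus the sum of the T(c'), where c' runs through the cycles obtained by inserting
    z in c, by the formula for the derivative of an inverse. Every permutation of
    N + 1 points arises exactly once from a permutation of the last N points by adding
    a fixed point or by inserting the new point in a cycle (cycle_sum_rec). The
    product rule therefore turns the sum over S_N into the sum over S_{N+1}
    (has_deriv0_moment_formula). *)

(** * Affine substitution in Lebesgue integrals *)

Section affine_change.
Context {R : realType}.
Local Notation mu := (@lebesgue_measure R).
Variables (r c : R).

Definition affine_map : measurableTypeR R -> measurableTypeR R :=
  fun x => r * x + c.

Lemma measurable_affine_map : measurable_fun setT affine_map.
Proof. exact: measurable_funD. Qed.

Definition affine_push := pushforward mu affine_map.

Let affine_push0 : affine_push set0 = 0%E.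
Proof. by rewrite /affine_push /pushforward preimage_set0 measure0. Qed.

Let affine_push_ge0 A : (0 <= affine_push A)%E.
Proof. by rewrite /affine_push /pushforward; exact: measure_ge0. Qed.

Let affine_push_sigma_additive : semi_sigma_additive affine_push.
Proof.
have mp A : measurable A -> measurable (affine_map @^-1` A).
  by move=> mA; rewrite -[X in measurable X]setTI; exact: measurable_affine_map.
move=> F mF tF mUF; rewrite /affine_push /pushforward preimage_bigcup.
apply: measure_semi_sigma_additive; first by move=> n; exact: mp.
  apply/trivIsetP => /= i j _ _ ij; rewrite -preimage_setI.
  by move/trivIsetP : tF => /(_ _ _ _ _ ij) ->//; rewrite preimage_set0.
by rewrite -preimage_bigcup; exact: mp.
Qed.

HB.instance Definition _ := isMeasure.Build _ _ _ affine_push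
  affine_push0 affine_push_ge0 affine_push_sigma_additive.

Hypothesis r0 : 0 < r.

(** Both sides are measures, so it is enough to compare them on half-open
    intervals. *)
Lemma lebesgue_measure_affine (A : set (measurableTypeR R)) :
  measurable A -> mu A = mscale (NngNum (ltW r0)) affine_push A.
Proof.
apply: lebesgue_measure_unique => //= X [[a b] _ <-] /=.
rewrite /mscale /= /affine_push /pushforward.
have -> : affine_map @^-1` `]a, b]%classic =
    `](a - c) / r, (b - c) / r]%classic :> set R.
  apply/seteqP; split => x /=; rewrite !in_itv/= /affine_map;
    by rewrite ltr_pdivrMr// ler_pdivlMr// ltrBlDr lerBrDr (mulrC x).
rewrite !lebesgue_measure_itv /= !lte_fin ltr_pM2r ?invr_gt0// ltrD2r.
case: ifPn => // _; last by rewrite mule0.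
by rewrite -EFinD -EFinM; congr EFin; field; rewrite gt_eqF.
Qed.

Lemma ge0_integral_affine (f : R -> \bar R) :
  measurable_fun setT f -> (forall x, 0 <= f x)%E ->
  (\int[mu]_x f x = r%:E * \int[mu]_x f (r * x + c)%R)%E.
Proof.
move=> mf f0.
rewrite (@eq_measure_integral _ _ _ setT
  (mscale (NngNum (ltW r0)) affine_push)); last first.
  by move=> A mA _; exact: lebesgue_measure_affine.
rewrite ge0_integral_mscale//= ge0_integral_pushforward//.
exact: measurable_affine_map.
Qed.

End affine_change.

(** * Integrals over one vertex and one edge *)

Section path_integrands.
Context {R : realType}.
Local Notation mu := (@lebesgue_measure R).

(** The contribution of a diagonal entry x of eta: a power of x and the part of
    exp(- tr(y eta)) that contains x. The indicator of x > 0 is built in, so that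
    the cone Q_G never has to appear as a domain of integration. *)
Definition vertex_factor (p a x : R) : R :=
  if 0 < x then x `^ p * expR (- (a * x)) else 0.

(** The contribution of the 2 x 2 block with diagonal x, x' and off-diagonal
    entry e: a power of its minor, cut off where the minor is not positive. *)
Definition edge_factor (q b x x' e : R) : R :=
  if 0 < x * x' - e ^+ 2 then (x * x' - e ^+ 2) `^ q * expR (- (2 * b * e))
  else 0.

Lemma vertex_factor_ge0 p a x : 0 <= vertex_factor p a x.
Proof.
rewrite /vertex_factor; case: ifP => // _.
by rewrite mulr_ge0// ?powR_ge0 ?expR_ge0.
Qed.

Lemma edge_factor_ge0 q b x x' e : 0 <= edge_factor q b x x' e.
Proof.
rewrite /edge_factor; case: ifP => // _.
by rewrite mulr_ge0// ?powR_ge0 ?expR_ge0.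
Qed.

Lemma edge_factorC q b x x' e : edge_factor q b x x' e = edge_factor q b x' x e.
Proof. by rewrite /edge_factor (mulrC x). Qed.

Section measurability.
Context d (T : measurableType d).

Lemma measurable_vertex_factor p a (x : T -> R) : measurable_fun setT x ->
  measurable_fun setT (fun t => vertex_factor p a (x t)).
Proof.
move=> mx; apply: measurable_fun_ifT => //.
  exact: measurable_fun_ltr.
apply: measurable_funM.
  exact: (measurableT_comp (measurable_powR _)).
apply: measurableT_comp => //; apply: measurableT_comp => //.
exact: measurable_funM.
Qed.

Lemma measurable_edge_factor q b (x x' e : T -> R) :
  measurable_fun setT x -> measurable_fun setT x' -> measurable_fun setT e ->
  measurable_fun setT (fun t => edge_factor q b (x t) (x' t) (e t)).
Proof.
move=> mx mx' me.
have m1 : measurable_fun setT (fun t => x t * x' t - e t ^+ 2).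
  apply: measurable_funB; first exact: measurable_funM.
  exact: measurable_funX.
apply: measurable_fun_ifT => //.
  exact: measurable_fun_ltr.
apply: measurable_funM.
  exact: (measurableT_comp (measurable_powR _)).
apply: measurableT_comp => //; apply: measurableT_comp => //.
exact: measurable_funM.
Qed.
End measurability.

Definition edge_kernel (q b x x' : R) : \bar R :=
  (\int[mu]_e (edge_factor q b x x' e)%:E)%E.

Lemma edge_kernel_ge0 q b x x' : (0 <= edge_kernel q b x x')%E.
Proof. by apply: integral_ge0 => e _; rewrite lee_fin edge_factor_ge0. Qed.

Lemma edge_kernelC q b x x' : edge_kernel q b x x' = edge_kernel q b x' x.
Proof. by apply: eq_integral => e _; rewrite edge_factorC. Qed.

Lemma measurable_edge_kernel q b d (T : measurableType d) (x x' : T -> R) :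
  measurable_fun setT x -> measurable_fun setT x' ->
  measurable_fun setT (fun t => edge_kernel q b (x t) (x' t)).
Proof.
move=> mx mx'.
have := @measurable_fun_fubini_tonelli_F _ _ T (measurableTypeR R) R mu
  (fun z : T * measurableTypeR R => (edge_factor q b (x z.1) (x' z.1) z.2)%:E).
apply.
  apply/measurable_EFinP; apply: measurable_edge_factor.
  - by apply: measurableT_comp => //; exact: measurable_fst.
  - by apply: measurableT_comp => //; exact: measurable_fst.
  - exact: measurable_snd.
by move=> z; rewrite lee_fin edge_factor_ge0.
Qed.

(** Euler's integral for Gamma (p + 1), with values in [0, +oo]. *)
Definition gamma_integral (p : R) : \bar R :=
  (\int[mu]_u (vertex_factor p 1 u)%:E)%E.

Definition gauss_mass : \bar R := (\int[mu]_u (expR (- u ^+ 2))%:E)%E.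

Lemma gamma_integral_ge0 p : (0 <= gamma_integral p)%E.
Proof. by apply: integral_ge0 => e _; rewrite lee_fin vertex_factor_ge0. Qed.

Lemma gauss_mass_ge0 : (0 <= gauss_mass)%E.
Proof. by apply: integral_ge0 => e _; rewrite lee_fin expR_ge0. Qed.

(** Rescaling x by d. *)
Lemma integral_vertex_factor p d : 0 < d ->
  (\int[mu]_x (vertex_factor p d x)%:E =
   (d `^ (- (p + 1)))%:E * gamma_integral p)%E.
Proof.
move=> d0; have d0' : 0 < d^-1 by rewrite invr_gt0.
rewrite (ge0_integral_affine 0 d0'); last 2 first.
- by apply/measurable_EFinP; exact: measurable_vertex_factor.
- by move=> x; rewrite lee_fin vertex_factor_ge0.
rewrite (_ : (d `^ (- (p + 1)))%:E = d^-1%:E * (d `^ (- p))%:E)%E; last first.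
  rewrite -EFinM -powR_inv1 1?ltW// -powRD ?(gt_eqF d0) ?implybT//.
  by congr (_ `^ _)%:E; ring.
rewrite -muleA; congr (_ * _)%E.
rewrite -ge0_integralZl//; last 3 first.
- by apply/measurable_EFinP; exact: measurable_vertex_factor.
- by move=> x _; rewrite lee_fin vertex_factor_ge0.
- by rewrite lee_fin powR_ge0.
apply: eq_integral => x _; rewrite -EFinM /vertex_factor addr0 pmulr_rgt0//.
case: ifPn => x0; last by rewrite mulr0.
rewrite powRM ?ltW// mulVKf ?gt_eqF// mul1r mulrA.
by rewrite -[in d^-1 `^ p]powR_inv1 1?ltW// -powRrM mulN1r.
Qed.

(** Completing the square: d e^2 / x + 2 b e equals
    (d / x) (e + b x / d)^2 - b^2 x / d. *)
Lemma integral_gaussian b d x : 0 < d -> 0 < x ->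
  (\int[mu]_e (expR (- (d * (e ^+ 2 / x)) - 2 * b * e))%:E =
   ((x / d) `^ (1 / 2) * expR (b ^+ 2 * x / d))%:E * gauss_mass)%E.
Proof.
move=> d0 x0.
have r0 : 0 < Num.sqrt (x / d) by rewrite sqrtr_gt0 divr_gt0.
rewrite (ge0_integral_affine (- (b * x / d)) r0); last 2 first.
- apply/measurable_EFinP; apply: measurableT_comp => //.
  apply: measurable_funB; last exact: measurable_funM.
  apply: measurableT_comp => //; apply: measurable_funM => //.
  by apply: measurable_funM => //; exact: measurable_funX.
- by move=> e; rewrite lee_fin expR_ge0.
rewrite EFinM -muleA mul1r powR12_sqrt; last by rewrite ltW// divr_gt0.
congr (_ * _)%E; rewrite -ge0_integralZl; last 4 first.
- exact: measurableT.
- apply/measurable_EFinP; apply: measurableT_comp => //.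
  apply: measurableT_comp => //; exact: measurable_funX.
- by move=> e _; rewrite lee_fin expR_ge0.
- by rewrite lee_fin expR_ge0.
apply: eq_integral => e _; rewrite -EFinM -expRD; congr (expR _)%:E.
have s2 : Num.sqrt (x / d) ^+ 2 = x / d by rewrite sqr_sqrtr// ltW// divr_gt0.
rewrite sqrrD exprMn s2; field; rewrite !gt_eqF//.
Qed.

(** The step that eliminates one vertex of the path. For a fixed off-diagonal
    entry e, the substitution a = v / d + e^2 / x turns the integral over a into
    Euler's integral; what remains in e is Gaussian. The result is again a power of
    x times an exponential that is linear in x, and the coefficient b^2 / d is the
    correction in the Schur complement of the eliminated vertex. *)
Lemma integral_edge_kernel q b d x : 0 < d -> 0 < x ->
  (\int[mu]_a ((vertex_factor 0 d a)%:E * edge_kernel q b a x) =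
   (x `^ (q + 1 / 2) * d `^ (- (q + 3 / 2)) * expR (b ^+ 2 * x / d))%:E *
   (gamma_integral q * gauss_mass))%E.
Proof.
move=> d0 x0; have d0' : 0 < d^-1 by rewrite invr_gt0.
have mjoint : measurable_fun [set: measurableTypeR R * measurableTypeR R]
    (fun z => (vertex_factor 0 d z.1 * edge_factor q b z.1 x z.2)%:E).
  apply/measurable_EFinP; apply: measurable_funM.
    by apply: measurable_vertex_factor; exact: measurable_fst.
  by apply: measurable_edge_factor.
have joint0 (z : measurableTypeR R * measurableTypeR R) :
    (0 <= (vertex_factor 0 d z.1 * edge_factor q b z.1 x z.2)%:E)%E.
  by rewrite lee_fin; apply: mulr_ge0; [exact: vertex_factor_ge0|exact: edge_factor_ge0].
transitivity (\int[mu]_a \int[mu]_e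
    (vertex_factor 0 d a * edge_factor q b a x e)%:E)%E.
  apply: eq_integral => a _; rewrite /edge_kernel -ge0_integralZl//.
  - by apply/measurable_EFinP; exact: measurable_edge_factor.
  - by move=> e _; rewrite lee_fin edge_factor_ge0.
  - by rewrite lee_fin vertex_factor_ge0.
rewrite (@fubini_tonelli _ _ _ _ R mu mu _ mjoint joint0)/=.
transitivity (\int[mu]_e ((d^-1 * (x / d) `^ q)%:E * gamma_integral q *
    (expR (- (d * (e ^+ 2 / x)) - 2 * b * e))%:E))%E.
  apply: eq_integral => e _.
  rewrite (ge0_integral_affine (e ^+ 2 / x) d0'); last 2 first.
  - apply/measurable_EFinP; apply: measurable_funM.
      exact: measurable_vertex_factor.
    exact: measurable_edge_factor.
  - move=> a; rewrite lee_fin.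
    by apply: mulr_ge0; [exact: vertex_factor_ge0|exact: edge_factor_ge0].
  rewrite EFinM -!muleA; congr (_ * _)%E.
  rewrite [X in (_ * X)%E]muleC muleA -EFinM -ge0_integralZl//; last 3 first.
  - by apply/measurable_EFinP; exact: measurable_vertex_factor.
  - by move=> a _; rewrite lee_fin vertex_factor_ge0.
  - by rewrite lee_fin mulr_ge0 ?powR_ge0 ?expR_ge0.
  apply: eq_integral => v _; rewrite -EFinM /edge_factor /vertex_factor.
  have -> : (d^-1 * v + e ^+ 2 / x) * x - e ^+ 2 = (x / d) * v.
    by field; rewrite !gt_eqF.
  rewrite pmulr_rgt0 ?divr_gt0//; case: (boolP (0 < v)) => v0; last by rewrite !mulr0.
  rewrite ifT; last by rewrite ltr_wpDr ?mulr_gt0 ?divr_ge0 ?sqr_ge0 ?ltW.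
  rewrite powRr0 mul1r powRM ?ltW ?divr_gt0//.
  congr EFin.
  rewrite [LHS](_ : _ = (x / d) `^ q * v `^ q *
     (expR (- (d * (d^-1 * v + e ^+ 2 / x))) * expR (- (2 * b * e)))); last by ring.
  rewrite [RHS](_ : _ = (x / d) `^ q * v `^ q *
     (expR (- (d * (e ^+ 2 / x)) - 2 * b * e) * expR (- (1 * v)))); last by ring.
  by rewrite -!expRD; congr (_ * expR _); field; rewrite !gt_eqF.
rewrite ge0_integralZl; last 4 first.
- exact: measurableT.
- apply/measurable_EFinP; apply: measurableT_comp => //.
  apply: measurable_funB; last exact: measurable_funM.
  apply: measurableT_comp => //; apply: measurable_funM => //.
  by apply: measurable_funM => //; exact: measurable_funX.
- by move=> e _; rewrite lee_fin expR_ge0.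
- by rewrite mule_ge0 ?gamma_integral_ge0// lee_fin mulr_ge0 ?powR_ge0 ?invr_ge0 ?ltW.
rewrite integral_gaussian// muleACA -EFinM; congr (_%:E * _)%E.
rewrite mulrA; congr (_ * _).
have xd q' : (x / d) `^ q' = x `^ q' * d `^ (- q').
  by rewrite powRM ?ltW// -powR_inv1 1?ltW// -powRrM mulN1r.
rewrite !xd [LHS](_ : _ = (x `^ q * x `^ (1 / 2)) *
  (d^-1 * d `^ (- q) * d `^ (- (1 / 2)))); last by ring.
rewrite -[d^-1]powR_inv1 1?ltW// -!powRD ?(gt_eqF d0) ?(gt_eqF x0) ?implybT//.
by congr (_ * _ `^ _); field.
Qed.

End path_integrands.

(** * Integration along a path *)

Section tuple_integrals.
Context {R : realType}.
Local Notation mu := (@lebesgue_measure R).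
Local Open Scope ereal_scope.

Lemma ge0_integral_lebesgue_tupleS (k : nat) (F : k.+1.-tuple R -> \bar R) :
  measurable_fun setT F -> (forall t, 0 <= F t) ->
  \int[lebesgue_tuple k.+1]_t F t =
  \int[mu]_x \int[lebesgue_tuple k]_t F (tuple_cons (x, t)).
Proof.
move=> mF F0; rewrite /= ge0_integral_pushforward//; last first.
  exact: measurable_tuple_cons.
rewrite preimage_setT.
rewrite (@fubini_tonelli1 _ _ _ _ R mu (lebesgue_tuple k) (F \o @tuple_cons R k))//.
  by apply: measurableT_comp => //; exact: measurable_tuple_cons.
by move=> z /=.
Qed.

Lemma ge0_integral_lebesgue_tuple0 (F : 0.-tuple R -> \bar R) :
  measurable_fun setT F -> (forall t, 0 <= F t) ->
  \int[lebesgue_tuple 0]_t F t = F [tuple].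
Proof. by move=> mF F0; rewrite /= integral_dirac// diracT mul1e. Qed.

Lemma measurable_tuple_nth (k i : nat) :
  measurable_fun setT (fun t : k.-tuple R => nth 0%R t i).
Proof.
have [ik|ki] := ltnP i k; last first.
  rewrite (_ : (fun t : k.-tuple R => nth 0%R t i) = cst 0%R)//.
  by apply/funext => t; rewrite nth_default// size_tuple.
rewrite (_ : (fun t : k.-tuple R => nth 0%R t i) = fun t => tnth t (Ordinal ik)).
  exact: measurable_tnth.
by apply/funext => t; rewrite (tnth_nth 0%R).
Qed.

(** The joint density on the path with vertices 0, ..., k, as a function of the
    diagonal entries t and the off-diagonal entries e. The recursion removes the
    first vertex, which is the order in which the measure on tuples is built. *)
Fixpoint path_density (k : nat) (p a q b t e : nat -> R) : R :=
  (vertex_factor (p 0%N) (a 0%N) (t 0%N) *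
   if k is k'.+1 then
     edge_factor (q 0%N) (b 0%N) (t 0%N) (t 1%N) (e 0%N) *
     path_density k' (p \o S) (a \o S) (q \o S) (b \o S) (t \o S) (e \o S)
   else 1)%R.

(** What is left of the density when the off-diagonal entries are integrated
    out: a product over the edges of kernels in the two diagonal entries. *)
Fixpoint path_weight (k : nat) (f : nat -> R -> \bar R)
    (G : nat -> R -> R -> \bar R) (t : nat -> R) : \bar R :=
  (f 0%N (t 0%N) *
   if k is k'.+1 then
     G 0%N (t 0%N) (t 1%N) * path_weight k' (f \o S) (G \o S) (t \o S)
   else 1).

(** The integral over all vertices but the first, as a function of the entry at
    the first vertex: the message that reaches this vertex from the rest of the
    path in the transfer-operator (sum-product) scheme. *)
Fixpoint message (k : nat) (f : nat -> R -> \bar R)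
    (G : nat -> R -> R -> \bar R) (x : R) : \bar R :=
  (f 0%N x *
   if k is k'.+1 then
     \int[mu]_x' (G 0%N x x' * message k' (f \o S) (G \o S) x')
   else 1).

Lemma path_densityE k p a q b t e : path_density k p a q b t e =
  ((\prod_(i < k.+1) vertex_factor (p i) (a i) (t i)) *
   \prod_(i < k) edge_factor (q i) (b i) (t i) (t i.+1) (e i))%R.
Proof.
elim: k p a q b t e => [|k IH] p a q b t e /=.
  by rewrite big_ord1 big_ord0.
rewrite IH [in RHS](big_ord_recl k.+1) mulrA.
by rewrite [X in _ = (_ * X)%R](big_ord_recl k) [RHS]mulrACA.
Qed.

Lemma path_density_ge0 k p a q b t e : (0 <= path_density k p a q b t e)%R.
Proof.
by rewrite path_densityE mulr_ge0 ?prodr_ge0// => i _;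
  [exact: vertex_factor_ge0|exact: edge_factor_ge0].
Qed.

Lemma measurable_path_density k p a q b d (T : measurableType d)
    (t e : nat -> T -> R) :
  (forall i, measurable_fun setT (t i)) -> (forall i, measurable_fun setT (e i)) ->
  measurable_fun setT (fun w => path_density k p a q b (t ^~ w) (e ^~ w)).
Proof.
move=> mt me; rewrite (_ : (fun w => _) = fun w =>
  ((\prod_(i < k.+1) vertex_factor (p i) (a i) (t i w)) *
   \prod_(i < k) edge_factor (q i) (b i) (t i w) (t i.+1 w) (e i w))%R); last first.
  by apply/funext => w; exact: path_densityE.
apply: measurable_funM; apply: measurable_prod => i _.
  exact: measurable_vertex_factor.
exact: measurable_edge_factor.
Qed.

(** By Tonelli, since each off-diagonal entry occurs in one factor only. *)
Lemma integral_path_density_edges k p a q b t :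
  \int[lebesgue_tuple k]_e (path_density k p a q b t (nth 0%R e))%:E =
  path_weight k (fun i x => (vertex_factor (p i) (a i) x)%:E)
    (fun i => edge_kernel (q i) (b i)) t.
Proof.
elim: k p a q b t => [|k IH] p a q b t.
  rewrite ge0_integral_lebesgue_tuple0//=.
  by move=> e; rewrite lee_fin mulr1; exact: vertex_factor_ge0.
rewrite ge0_integral_lebesgue_tupleS; last 2 first.
- apply/measurable_EFinP; apply: (@measurable_path_density k.+1 p a q b _ _
    (fun i _ => t i) (fun i (e : k.+1.-tuple R) => nth 0%R e i)) => // i.
  exact: measurable_tuple_nth.
- by move=> e; rewrite lee_fin; exact: path_density_ge0.
have md : measurable_fun setT (fun e : k.-tuple R => (path_density k (p \o S)
    (a \o S) (q \o S) (b \o S) (t \o S) (nth 0%R e))%:E).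
  apply/measurable_EFinP; apply: (@measurable_path_density k _ _ _ _ _ _
    (fun i _ => t i.+1) (fun i (e : k.-tuple R) => nth 0%R e i)) => // i.
  exact: measurable_tuple_nth.
transitivity (\int[mu]_x ((vertex_factor (p 0%N) (a 0%N) (t 0%N))%:E *
   path_weight k (fun i x => (vertex_factor (p i.+1) (a i.+1) x)%:E)
    (fun i => edge_kernel (q i.+1) (b i.+1)) (t \o S) *
    (edge_factor (q 0%N) (b 0%N) (t 0%N) (t 1%N) x)%:E)).
  apply: eq_integral => x _.
  rewrite -(IH (p \o S) (a \o S) (q \o S) (b \o S) (t \o S)) muleAC -EFinM.
  rewrite -ge0_integralZl//.
  - by apply: eq_integral => e _; rewrite -EFinM; congr EFin; rewrite /= mulrA.
  - by move=> e _; rewrite lee_fin; exact: path_density_ge0.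
  - by rewrite lee_fin; apply: mulr_ge0; [exact: vertex_factor_ge0|exact: edge_factor_ge0].
rewrite ge0_integralZl; last 4 first.
- exact: measurableT.
- by apply/measurable_EFinP; exact: measurable_edge_factor.
- by move=> x _; rewrite lee_fin; exact: edge_factor_ge0.
- rewrite -(IH (p \o S) (a \o S) (q \o S) (b \o S) (t \o S)).
  apply: mule_ge0; first by rewrite lee_fin; exact: vertex_factor_ge0.
  by apply: integral_ge0 => e _; rewrite lee_fin; exact: path_density_ge0.
by rewrite /= -muleA; congr (_ * _); rewrite muleC.
Qed.

Section message.
Implicit Types (f : nat -> R -> \bar R) (G : nat -> R -> R -> \bar R).

Lemma measurable_sections (g : R -> R -> \bar R) :
  measurable_fun setT (fun z : R * R => g z.1 z.2) ->
  (forall x, measurable_fun setT (g x)) * (forall x', measurable_fun setT (g ^~ x')).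
Proof.
move=> mg; split=> x.
  rewrite -[g x]/((fun z => g z.1 z.2) \o (fun w => (x, w))).
  by apply: (measurableT_comp mg); exact: measurable_fun_pair.
rewrite -[g ^~ x]/((fun z => g z.1 z.2) \o (fun w => (w, x))).
by apply: (measurableT_comp mg); exact: measurable_fun_pair.
Qed.

Lemma message_ge0 k f G x : (forall i x, 0 <= f i x) ->
  (forall i x x', 0 <= G i x x') -> 0 <= message k f G x.
Proof.
elim: k f G x => [|k IH] f G x f0 G0 /=; first by rewrite mule1.
apply: mule_ge0 => //; apply: integral_ge0 => x' _; apply: mule_ge0 => //.
by apply: IH => *; [exact: f0|exact: G0].
Qed.

Lemma measurable_message k f G :
  (forall i x, 0 <= f i x) -> (forall i x x', 0 <= G i x x') ->
  (forall i, measurable_fun setT (f i)) ->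
  (forall i, measurable_fun setT (fun z : R * R => G i z.1 z.2)) ->
  measurable_fun setT (message k f G).
Proof.
elim: k f G => [|k IH] f G f0 G0 mf mG /=.
  by under eq_fun do rewrite mule1; exact: mf.
apply: emeasurable_funM => //.
apply: (@measurable_fun_fubini_tonelli_F _ _ (measurableTypeR R) (measurableTypeR R) R mu
  (fun z : measurableTypeR R * measurableTypeR R =>
     G 0%N z.1 z.2 * message k (f \o S) (G \o S) z.2)).
  apply: emeasurable_funM; first exact: mG.
  apply: (@measurableT_comp _ _ _ _ _ _ (message k (f \o S) (G \o S))).
    by apply: IH => *; [exact: f0|exact: G0|exact: mf|exact: mG].
  exact: measurable_snd.
move=> z; apply: mule_ge0 => //.
by apply: message_ge0 => *; [exact: f0|exact: G0].
Qed.

Lemma path_weight_ge0 k f G t : (forall i x, 0 <= f i x) ->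
  (forall i x x', 0 <= G i x x') -> 0 <= path_weight k f G t.
Proof.
elim: k f G t => [|k IH] f G t f0 G0 /=; first by rewrite mule1.
apply: mule_ge0 => //; apply: mule_ge0 => //.
by apply: IH => *; [exact: f0|exact: G0].
Qed.

Lemma measurable_path_weight k f G d (T : measurableType d) (t : nat -> T -> R) :
  (forall i, measurable_fun setT (f i)) ->
  (forall i, measurable_fun setT (fun z : R * R => G i z.1 z.2)) ->
  (forall i, measurable_fun setT (t i)) ->
  measurable_fun setT (fun w => path_weight k f G (t ^~ w)).
Proof.
elim: k f G t => [|k IH] f G t mf mG mt /=.
  by under eq_fun do rewrite mule1; exact: measurableT_comp.
apply: emeasurable_funM; first exact: (measurableT_comp (mf _) (mt _)).
apply: emeasurable_funM.
  exact: (measurableT_comp (mG 0%N) (measurable_fun_pair (mt 0%N) (mt 1%N))).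
by apply: (IH (f \o S) (G \o S) (fun i => t i.+1)) => i; [exact: mf|exact: mG|exact: mt].
Qed.

(** Multiplying the weight of the first vertex commutes with the recursions
    above; this is how the neighbouring factor is absorbed at each step. *)
Definition scale_head (h : R -> \bar R) f : nat -> R -> \bar R :=
  fun i => if i is 0%N then fun x => h x * f 0%N x else f i.

Lemma path_weight_scale_head k h f G t :
  path_weight k (scale_head h f) G t = h (t 0%N) * path_weight k f G t.
Proof. by case: k => [|k] /=; rewrite !muleA. Qed.

Lemma message_scale_head k h f G x :
  message k (scale_head h f) G x = h x * message k f G x.
Proof. by case: k => [|k] /=; rewrite !muleA. Qed.

(** Induction on the length, for all weights at once: the factors that link the
    removed vertex to the rest are absorbed in the weight of its neighbour. *)
Lemma integral_path_weight k f G :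
  (forall i x, 0 <= f i x) -> (forall i x x', 0 <= G i x x') ->
  (forall i, measurable_fun setT (f i)) ->
  (forall i, measurable_fun setT (fun z : R * R => G i z.1 z.2)) ->
  \int[lebesgue_tuple k.+1]_t path_weight k f G (nth 0%R t) =
  \int[mu]_x message k f G x.
Proof.
elim: k f G => [|k IH] f G f0 G0 mf mG.
  rewrite ge0_integral_lebesgue_tupleS; last 2 first.
  - apply: (@measurable_path_weight 0 f G _ _ (fun i (t : 1.-tuple R) => nth 0%R t i)) => //.
    by move=> i; exact: measurable_tuple_nth.
  - by move=> t; exact: path_weight_ge0.
  apply: eq_integral => x _; rewrite ge0_integral_lebesgue_tuple0//.
  - exact: (measurable_cst (f 0%N x * 1)).
  - by move=> t; exact: path_weight_ge0.
rewrite ge0_integral_lebesgue_tupleS; last 2 first.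
- apply: (@measurable_path_weight k.+1 f G _ _ (fun i (t : k.+2.-tuple R) => nth 0%R t i)) => //.
  by move=> i; exact: measurable_tuple_nth.
- by move=> t; exact: path_weight_ge0.
apply: eq_integral => x _.
pose f' := scale_head (G 0%N x) (f \o S).
have f'0 i x' : 0 <= f' i x'.
  by case: i => [|i] /=; [exact: mule_ge0|exact: f0].
have mf' i : measurable_fun setT (f' i).
  case: i => [|i] /=; last exact: mf.
  apply: emeasurable_funM => //.
  by have [] := measurable_sections (mG 0%N).
transitivity (\int[lebesgue_tuple k.+1]_t (f 0%N x * path_weight k f' (G \o S) (nth 0%R t))).
  by apply: eq_integral => t _; rewrite path_weight_scale_head.
rewrite ge0_integralZl//; last 2 first.
- apply: (@measurable_path_weight k f' (G \o S) _ _ (fun i (t : k.+1.-tuple R) => nth 0%R t i)) => //.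
    by move=> i; exact: mG.
  by move=> i; exact: measurable_tuple_nth.
- by move=> t _; apply: path_weight_ge0 => // *; exact: G0.
rewrite (IH f' (G \o S))//; last 2 first.
- by move=> *; exact: G0.
- by move=> *; exact: mG.
by congr (_ * _); apply: eq_integral => x' _; rewrite message_scale_head.
Qed.

(** The same integral, eliminating the first vertex instead of peeling the path
    from its far end; one exchange of integrals. *)
Lemma integral_message_elim k f G :
  (forall i x, 0 <= f i x) -> (forall i x x', 0 <= G i x x') ->
  (forall i, measurable_fun setT (f i)) ->
  (forall i, measurable_fun setT (fun z : R * R => G i z.1 z.2)) ->
  \int[mu]_x message k.+1 f G x =
  \int[mu]_x' ((\int[mu]_x (f 0%N x * G 0%N x x')) *
     message k (f \o S) (G \o S) x').
Proof.
move=> f0 G0 mf mG.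
have M0 x : 0 <= message k (f \o S) (G \o S) x.
  by apply: message_ge0 => *; [exact: f0|exact: G0].
have mM : measurable_fun setT (message k (f \o S) (G \o S)).
  by apply: measurable_message => *; [exact: f0|exact: G0|exact: mf|exact: mG].
have mGx x : measurable_fun setT (G 0%N x).
  by have [] := measurable_sections (mG 0%N).
have mGx' x' : measurable_fun setT (G 0%N ^~ x').
  by have [] := measurable_sections (mG 0%N).
transitivity (\int[mu]_x \int[mu]_x'
    (f 0%N x * G 0%N x x' * message k (f \o S) (G \o S) x')).
  apply: eq_integral => x _ /=; rewrite -ge0_integralZl//.
  - by apply: eq_integral => x' _; rewrite muleA.
  - by apply: emeasurable_funM; [exact: mGx|exact: mM].
  - by move=> x' _; exact: mule_ge0.
rewrite (@fubini_tonelli _ _ (measurableTypeR R) (measurableTypeR R) R mu mu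
  (fun z => f 0%N z.1 * G 0%N z.1 z.2 * message k (f \o S) (G \o S) z.2))/=.
- apply: eq_integral => x' _; rewrite muleC -ge0_integralZl//.
  + by apply: eq_integral => x _; rewrite muleC.
  + by apply: emeasurable_funM; [exact: mf|exact: mGx'].
  + by move=> x _; exact: mule_ge0.
- apply: emeasurable_funM.
    apply: emeasurable_funM; last exact: mG.
    by apply: (measurableT_comp (mf 0%N)); exact: measurable_fst.
  by apply: (measurableT_comp mM); exact: measurable_snd.
- by move=> z; apply: mule_ge0 => //; exact: mule_ge0.
Qed.

End message.

End tuple_integrals.

(** * Continuants and elimination of vertices *)

Section continuant_recurrences.
Context {R : realType}.
Implicit Types (a b s : nat -> R) (k M : nat).

(** The determinant of the symmetric tridiagonal matrix of order k with diagonal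
    a and off-diagonal b, by its three-term recurrence. *)
Fixpoint continuant k a b : R :=
  if k is k'.+1 then
    a 0%N * continuant k' (a \o S) (b \o S) -
    (if k' is k''.+1 then b 0%N ^+ 2 * continuant k'' (a \o S \o S) (b \o S \o S)
     else 0)
  else 1.

Lemma continuantSS k a b : continuant k.+2 a b =
  a 0%N * continuant k.+1 (a \o S) (b \o S) -
  b 0%N ^+ 2 * continuant k (a \o S \o S) (b \o S \o S).
Proof. by []. Qed.

Lemma continuant1 a b : continuant 1 a b = a 0%N.
Proof. by rewrite /= mulr1 subr0. Qed.

(** The diagonal after elimination of vertex 0: its neighbour receives the Schur
    complement a_1 - b_0^2 / a_0 and the others do not change. *)
Definition eliminate a b : nat -> R :=
  fun i => if i is 0%N then a 1%N - b 0%N ^+ 2 / a 0%N else a i.+1.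

(** A determinant is the pivot times the determinant of the Schur complement. *)
Lemma continuant_eliminate k a b : a 0%N != 0 ->
  continuant k.+2 a b = a 0%N * continuant k.+1 (eliminate a b) (b \o S).
Proof.
move=> a0; rewrite continuantSS.
have e0 : eliminate a b 0%N = a 1%N - b 0%N ^+ 2 / a 0%N by [].
have eS : eliminate a b \o S = a \o S \o S by [].
case: k => [|k]; first by rewrite !continuant1 e0 /=; field.
by rewrite !continuantSS eS e0 /=; field.
Qed.

Definition nshift i a : nat -> R := fun j => a (i + j)%N.

(** The minors that occur in the closed form when the marked vertex is M. *)
Definition positive_minors M k a b :=
  [/\ forall i, (i < M)%N -> 0 < continuant i.+1 a b,
      0 < continuant k.+1 a b &
      forall i, (M < i <= k)%N -> 0 < continuant (k.+1 - i) (nshift i a) (nshift i b)].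

(** Minus the logarithm of the Laplace transform, up to a constant, with vertices
    numbered from 0. *)
Definition log_laplace M k s a b : R :=
  \sum_(0 <= i < M) (s i - s i.+1) * ln (continuant i.+1 a b) +
  s M * ln (continuant k.+1 a b) +
  \sum_(M.+1 <= i < k.+1) (s i - s i.-1) *
    ln (continuant (k.+1 - i) (nshift i a) (nshift i b)).

Lemma positive_minors_right k a b : positive_minors 0 k.+1 a b ->
  positive_minors 0 k (a \o S) (b \o S).
Proof.
move=> [_ _ H]; split => //; first by have /(_ isT) := H 1%N.
by move=> i /andP[_ ik]; have /(_ ik) := H i.+1.
Qed.

Lemma positive_minors_left M k a b : positive_minors M.+1 k.+1 a b ->
  0 < a 0%N /\ positive_minors M k (eliminate a b) (b \o S).
Proof.
move=> [H1 H2 H3].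
have a0 : 0 < a 0%N by have /(_ isT) := H1 0%N; rewrite continuant1.
have a0' : a 0%N != 0 by rewrite gt_eqF.
split => //; split.
- move=> i iM; by have /(_ iM) := H1 i.+1; rewrite continuant_eliminate// pmulr_rgt0.
- by move: H2; rewrite continuant_eliminate// pmulr_rgt0.
- by move=> [//|i] ik; have /(_ ik) := H3 i.+2.
Qed.

(** All minors that contain vertex 0 split off the factor a_0, and the exponents
    of these factors telescope to s_0. *)
Lemma log_laplace_left M k s a b : (M <= k)%N -> positive_minors M.+1 k.+1 a b ->
  log_laplace M.+1 k.+1 s a b =
  s 0%N * ln (a 0%N) + log_laplace M k (s \o S) (eliminate a b) (b \o S).
Proof.
move=> Mk H; have [a0 [P1 P2 P3]] := positive_minors_left H.
have a0' : a 0%N != 0 by rewrite gt_eqF.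
have lnE i : 0 < continuant i.+1 (eliminate a b) (b \o S) ->
    ln (continuant i.+2 a b) =
    ln (a 0%N) + ln (continuant i.+1 (eliminate a b) (b \o S)).
  by move=> c0; rewrite continuant_eliminate// lnM ?posrE.
rewrite /log_laplace big_nat_recl// continuant1 lnE//.
rewrite (eq_big_nat _ _ (F2 := fun i => (s i.+1 - s i.+2) * ln (a 0%N) +
    (s i.+1 - s i.+2) * ln (continuant i.+1 (eliminate a b) (b \o S)))); last first.
  by move=> i iM; rewrite lnE ?P1// mulrDr.
rewrite big_split/= -mulr_suml (eq_bigr (fun i => - (s i.+2 - s i.+1))); last first.
  by move=> i _; rewrite opprB.
rewrite sumrN telescope_sumr// [X in _ + X = _]big_add1/=.
rewrite (eq_big_nat _ _ (F1 := fun i => (s i.+1 - s i) * _) (F2 := fun i =>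
   (s i.+1 - (s \o S) i.-1) *
   ln (continuant (k.+1 - i) (nshift i (eliminate a b)) (nshift i (b \o S))))); last first.
  by move=> [//|i] _; rewrite subSS.
ring.
Qed.

(** The minors of the intervals {i : k} with i > 0 are those of the path without
    vertex 0; only the coefficient of the minor of {1 : k} differs, by s_0. *)
Lemma log_laplace_right k s a b :
  log_laplace 0 k.+1 s a b =
  s 0%N * (ln (continuant k.+2 a b) - ln (continuant k.+1 (a \o S) (b \o S))) +
  log_laplace 0 k (s \o S) (a \o S) (b \o S).
Proof.
rewrite /log_laplace ![\sum_(0 <= i < 0) _]big_geq// !add0r.
rewrite [\sum_(1 <= i < k.+2) _]big_ltn// subSS subn0 [X in _ + (_ + X) = _]big_add1/=.
rewrite -[ln (continuant k.+1 (nshift 1 a) _)]/(ln (continuant k.+1 (a \o S) (b \o S))).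
rewrite (eq_big_nat _ _ (F1 := fun i => (s i.+1 - s i) * _) (F2 := fun i =>
   (s i.+1 - (s \o S) i.-1) *
   ln (continuant (k.+1 - i) (nshift i (a \o S)) (nshift i (b \o S))))); last first.
  by move=> [//|i] _; rewrite subSS.
ring.
Qed.

End continuant_recurrences.

(** * The path integral in closed form *)

Section laplace_transform.
Context {R : realType}.
Local Notation mu := (@lebesgue_measure R).
Implicit Types (a b s : nat -> R) (k M : nat).

(** The exponent of eta_ii in delta * phi. Each vertex up to M contributes for the
    edge on its left, each vertex from M on for the edge on its right, so M collects
    both contributions besides its own s_M - 1. *)
Definition vertex_exponent M k s (i : nat) : R :=
  (if (0 < i <= M)%N then 1 - s i.-1 else 0) +
  (if (M <= i < k)%N then 1 - s i.+1 else 0) +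
  (if i == M then s M - 1 else 0).

Definition edge_exponent M s (i : nat) : R :=
  (if (i < M)%N then s i else s i.+1) - 3 / 2.

Definition right_exponent k s (i : nat) : R :=
  if (i < k)%N then 1 - s i.+1 else 0.

Definition vertex_factors (p a : nat -> R) : nat -> R -> \bar R :=
  fun i x => (vertex_factor (p i) (a i) x)%:E.

Definition edge_kernels (q b : nat -> R) : nat -> R -> R -> \bar R :=
  fun i => edge_kernel (q i) (b i).

Lemma vertex_factors_ge0 p a i x : (0 <= vertex_factors p a i x)%E.
Proof. by rewrite lee_fin; exact: vertex_factor_ge0. Qed.

Lemma edge_kernels_ge0 q b i x x' : (0 <= edge_kernels q b i x x')%E.
Proof. exact: edge_kernel_ge0. Qed.

Lemma measurable_vertex_factors p a i : measurable_fun setT (vertex_factors p a i).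
Proof. by apply/measurable_EFinP; exact: measurable_vertex_factor. Qed.

Lemma measurable_edge_kernels q b i :
  measurable_fun setT (fun z : R * R => edge_kernels q b i z.1 z.2).
Proof. exact: measurable_edge_kernel. Qed.

Lemma vertex_factorD (p p' a a' x : R) :
  (vertex_factor (p + p') (a + a') x =
   x `^ p * expR (- (a * x)) * vertex_factor p' a' x)%R.
Proof.
rewrite /vertex_factor; case: ifPn => x0; last by rewrite mulr0.
rewrite powRD ?(gt_eqF x0) ?implybT// mulrDl opprD expRD; ring.
Qed.

Lemma mule_rearrange (A B K F1 F2 : R) (C g : \bar R) : A * B * K = F1 * F2 ->
  (A%:E * (C * B%:E * (K%:E * g)) = C * g * F1%:E * F2%:E)%E.
Proof.
move=> H; rewrite -[RHS]muleA -EFinM -H !EFinM [RHS]muleC.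
by rewrite (muleC C) -(muleA B%:E) (muleCA C) !muleA.
Qed.

(** On the side of M that is eliminated from the far end, the message is at every
    step a constant times exp(- rp x), where rp is the current pivot: the power of x
    produced by the kernel cancels the exponent 1 - s_{i+1} of the vertex. The pivot
    is a quotient of consecutive minors. The constant C does not depend on a and b,
    and may a priori be infinite. *)
Lemma right_message k s : exists2 C : \bar R, (0 <= C)%E &
  forall a b x, positive_minors 0 k a b ->
  message k (vertex_factors (right_exponent k s) a)
    (edge_kernels (fun i => s i.+1 - 3 / 2) b) x =
  (C * (expR (s 0%N * (ln (continuant k.+1 a b) -
                       ln (continuant k (a \o S) (b \o S))) -
             log_laplace 0 k s a b))%:E *
   (vertex_factor 0 (continuant k.+1 a b / continuant k (a \o S) (b \o S)) x)%:E)%E.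
Proof.
elim: k s => [|k IH] s.
  exists 1%E => // a b x _; rewrite /log_laplace !big_geq// continuant1 /=.
  by rewrite ln1 subr0 add0r addr0 subrr expR0 !mul1e mule1 divr1.
have [C C0 HC] := IH (s \o S).
set gg := (gamma_integral (s 1%N - 3 / 2) * gauss_mass)%E.
have gg0 : (0 <= gg)%E by rewrite mule_ge0 ?gamma_integral_ge0 ?gauss_mass_ge0.
exists (C * gg)%E; first by rewrite mule_ge0.
move=> a b x /[dup] pos /positive_minors_right pos'.
have c0 : 0 < continuant k.+1 (a \o S) (b \o S) by case: pos'.
have c0' : 0 < continuant k (a \o S \o S) (b \o S \o S).
  case: (k) pos' => [|k'] [_ _ H]; first by rewrite ltr01.
  by have /(_ isT) := H 1%N.
(* the pivot of vertex 1 when all vertices after it have been eliminated *)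
set rp := continuant k.+1 (a \o S) (b \o S) / continuant k (a \o S \o S) (b \o S \o S).
have rp0 : 0 < rp by rewrite divr_gt0.
have rpE : continuant k.+2 a b / continuant k.+1 (a \o S) (b \o S) =
           a 0%N - b 0%N ^+ 2 / rp.
  by rewrite continuantSS /rp; field; rewrite !gt_eqF.
rewrite rpE log_laplace_right.
set LL := log_laplace 0 k _ _ _.
set l0 := s 0%N * _.
rewrite (_ : l0 - (l0 + LL) = - LL); last by ring.
have lrp : ln rp = ln (continuant k.+1 (a \o S) (b \o S)) -
    ln (continuant k (a \o S \o S) (b \o S \o S)) by rewrite ln_div ?posrE.
rewrite [LHS]/=.
have [x0|x0] := ltP 0 x; last first.
  by rewrite /vertex_factors /vertex_factor ltNge x0/= mul0e mule0.
transitivity ((vertex_factor (right_exponent k.+1 s 0) (a 0%N) x)%:E *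
  (C * (expR (s 1%N * ln rp - LL))%:E *
   \int[mu]_x' ((vertex_factor 0 rp x')%:E *
               edge_kernel (s 1%N - 3 / 2) (b 0%N) x' x)))%E.
  congr (_ * _)%E; rewrite -ge0_integralZl//; last 3 first.
  - apply: emeasurable_funM; last exact: measurable_edge_kernel.
    by apply/measurable_EFinP; exact: measurable_vertex_factor.
  - move=> y _; apply: mule_ge0; last exact: edge_kernel_ge0.
    by rewrite lee_fin; exact: vertex_factor_ge0.
  - by rewrite mule_ge0// lee_fin expR_ge0.
  apply: eq_integral => y _.
  have := HC (a \o S) (b \o S) y pos'; rewrite -lrp -/rp -/LL /= => Hy.
  rewrite (_ : message k _ _ y = message k
      (vertex_factors (right_exponent k (s \o S)) (a \o S))
      (edge_kernels (fun i => (s \o S) i.+1 - 3 / 2) (b \o S)) y)//.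
  by rewrite Hy /edge_kernels edge_kernelC muleC muleA.
rewrite integral_edge_kernel// -/gg; apply: mule_rearrange.
rewrite /vertex_factor x0 /right_exponent /= powRr0.
have -> : s 1%N - 3 / 2 + 1 / 2 = s 1%N - 1 by lra.
have -> : - (s 1%N - 3 / 2 + 3 / 2) = - s 1%N by lra.
rewrite (_ : rp `^ (- s 1%N) = expR (- s 1%N * ln rp)); last first.
  by rewrite /powR (gt_eqF rp0).
rewrite (_ : x `^ (1 - s 1%N) = expR ((1 - s 1%N) * ln x)); last first.
  by rewrite /powR (gt_eqF x0).
rewrite (_ : x `^ (s 1%N - 1) = expR ((s 1%N - 1) * ln x)); last first.
  by rewrite /powR (gt_eqF x0).
rewrite mul1r -!expRD; congr expR; field.
by rewrite gt_eqF.
Qed.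

(** Vertices before M are eliminated from the left, each one giving the factor
    a_0^(- s_0); once M is the first vertex, the message from the right makes the
    remaining integral one of Euler's. *)
Lemma path_laplace M k s : (M <= k)%N -> exists2 C : \bar R, (0 <= C)%E &
  forall a b, positive_minors M k a b ->
  (\int[mu]_x message k (vertex_factors (vertex_exponent M k s) a)
    (edge_kernels (edge_exponent M s) b) x =
  C * (expR (- log_laplace M k s a b))%:E)%E.
Proof.
elim: M k s => [|M IH] k s Mk.
  have [C C0 HC] := right_message k s.
  exists (C * gamma_integral (s 0%N - 1))%E.
    by rewrite mule_ge0// gamma_integral_ge0.
  move=> a b pos.
  set rp := continuant k.+1 a b / continuant k (a \o S) (b \o S).
  have c0 : 0 < continuant k.+1 a b by case: pos.
  have c0' : 0 < continuant k (a \o S) (b \o S).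
    case: (k) pos => [|k'] [_ _ H]; first by rewrite ltr01.
    by have /(_ isT) := H 1%N.
  have rp0 : 0 < rp by rewrite divr_gt0.
  set E := expR (s 0%N * (ln (continuant k.+1 a b) -
             ln (continuant k (a \o S) (b \o S))) - log_laplace 0 k s a b).
  transitivity (\int[mu]_x (C * E%:E * (vertex_factor (s 0%N - 1) rp x)%:E))%E.
    apply: eq_integral => x _.
    rewrite (_ : vertex_factors _ a = scale_head
        (fun x => (x `^ (s 0%N - 1) * expR (- (0 * x)))%:E)
        (vertex_factors (right_exponent k s) a)); last first.
      apply/funext => -[|i]; apply/funext => y; rewrite /vertex_factors/=.
        rewrite -EFinM -vertex_factorD add0r /vertex_exponent/= add0r addrC.
        by rewrite /right_exponent.
      by rewrite /vertex_exponent/= add0r addr0.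
    rewrite message_scale_head.
    rewrite (HC a b x pos) muleCA -EFinM -vertex_factorD.
    by rewrite addr0 add0r.
  rewrite ge0_integralZl//; last 3 first.
  - by apply/measurable_EFinP; exact: measurable_vertex_factor.
  - by move=> x _; rewrite lee_fin vertex_factor_ge0.
  - by rewrite mule_ge0// lee_fin expR_ge0.
  rewrite integral_vertex_factor// muleA -(muleA C) -EFinM muleAC.
  congr (_ * _%:E)%E; rewrite /powR (gt_eqF rp0) -expRD; congr expR.
  by rewrite ln_div ?posrE//; ring.
case: k Mk => [//|k]; rewrite ltnS => Mk.
have [C C0 HC] := IH k (s \o S) Mk.
set gg := (gamma_integral (s 0%N - 3 / 2) * gauss_mass)%E.
have gg0 : (0 <= gg)%E by rewrite mule_ge0 ?gamma_integral_ge0 ?gauss_mass_ge0.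
exists (C * gg)%E; first by rewrite mule_ge0.
move=> a b pos; have [a0 pos'] := positive_minors_left pos.
rewrite integral_message_elim; last 4 first.
- exact: vertex_factors_ge0.
- exact: edge_kernels_ge0.
- exact: measurable_vertex_factors.
- exact: measurable_edge_kernels.
set p0 := vertex_exponent M k (s \o S).
(* the weights of the shorter path in which vertex 1 has become the first vertex *)
pose f1 := vertex_factors p0 (eliminate a b).
pose G1 := edge_kernels (edge_exponent M (s \o S)) (b \o S).
have f1E : vertex_factors (vertex_exponent M.+1 k.+1 s) a \o S = scale_head
    (fun x => (x `^ (1 - s 0%N) * expR (- (b 0%N ^+ 2 / a 0%N * x)))%:E) f1.
  apply/funext => -[|i]; apply/funext => y; rewrite /f1 /vertex_factors/=.
    rewrite -EFinM -vertex_factorD; congr (vertex_factor _ _ _)%:E.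
      by rewrite /p0 /vertex_exponent/= add0r addrA.
    by rewrite addrC subrK.
  by [].
transitivity (\int[mu]_x ((gg * (a 0%N `^ (- s 0%N))%:E) * message k f1 G1 x))%E.
  apply: eq_integral => x _; rewrite f1E message_scale_head.
  rewrite (_ : edge_kernels (edge_exponent M.+1 s) b \o S = G1)//.
  have [x0|x0] := ltP 0 x; last first.
    suff -> : message k f1 G1 x = 0%E by rewrite !mule0.
    case: (k) => [|k'] /=;
      by rewrite /f1 /vertex_factors /vertex_factor ltNge x0/= mul0e.
  rewrite muleA; congr (_ * _)%E.
  have -> : (\int[mu]_y (vertex_factors (vertex_exponent M.+1 k.+1 s) a 0 y *
       edge_kernels (edge_exponent M.+1 s) b 0 y x) =
     \int[mu]_y ((vertex_factor 0 (a 0%N) y)%:E *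
       edge_kernel (s 0%N - 3 / 2) (b 0%N) y x))%E.
    by apply: eq_integral => y _; rewrite /vertex_factors /vertex_exponent /= !add0r.
  rewrite integral_edge_kernel// -/gg muleAC -EFinM muleC; congr (_ * _%:E)%E.
  have -> : s 0%N - 3 / 2 + 1 / 2 = s 0%N - 1 by lra.
  have -> : - (s 0%N - 3 / 2 + 3 / 2) = - s 0%N by lra.
  rewrite /powR (gt_eqF x0) (gt_eqF a0) -!expRD; congr expR; field.
  by rewrite gt_eqF.
rewrite ge0_integralZl; last 4 first.
- exact: measurableT.
- apply: measurable_message => *.
  + exact: vertex_factors_ge0.
  + exact: edge_kernels_ge0.
  + exact: measurable_vertex_factors.
  + exact: measurable_edge_kernels.
- by move=> x _; apply: message_ge0 => *; [exact: vertex_factors_ge0|exact: edge_kernels_ge0].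
- by rewrite mule_ge0// lee_fin powR_ge0.
rewrite HC// log_laplace_left// muleCA !muleA -muleA -EFinM.
congr (_ * _%:E)%E; rewrite /powR (gt_eqF a0) -expRD; congr expR.
by ring.
Qed.

End laplace_transform.

(** * Principal minors of tridiagonal matrices *)

Section tridiagonal.
Context {R : realType}.
Implicit Types (a b : nat -> R) (k : nat).

Definition tridiag a b (i j : nat) : R :=
  if i == j then a i else if j == i.+1 then b i else if i == j.+1 then b j else 0.

Lemma det_tridiag k a b :
  \det (\matrix_(i < k, j < k) tridiag a b i j) = continuant k a b.
Proof.
elim/ltn_ind: k a b => -[|[|k]] IH a b.
- by rewrite det_mx00.
- by rewrite det_mx11 mxE continuant1.
rewrite (expand_det_row _ ord0) 2!big_ord_recl big1 ?addr0; last first.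
  by move=> i _; rewrite mxE /tridiag /= mul0r.
rewrite continuantSS -!IH// !mxE /cofactor /= expr0 expr1 mul1r.
congr (_ * _ + _).
  by congr (\det _); apply/matrixP => i j; rewrite !mxE.
rewrite /tridiag /= mulN1r mulrN; congr (- _).
rewrite (expand_det_col _ ord0) big_ord_recl big1 ?addr0; last first.
  by move=> i _; rewrite !mxE /tridiag /= mul0r.
rewrite /cofactor /= expr0 mul1r !mxE /tridiag/= mulrA -expr2.
by congr (_ * \det _); apply/matrixP => i j; rewrite !mxE.
Qed.

(** Entries given by a function of the natural numbers under the indices make it
    possible to change the type of the indices without casts. *)
Lemma det_nat_entries m k (A : 'M[R]_m) (f : nat -> nat -> R) : m = k ->
  (forall i j, A i j = f i j) -> \det A = \det (\matrix_(i < k, j < k) f i j).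
Proof. by move=> <- Af; congr (\det _); apply/matrixP => i j; rewrite mxE Af. Qed.

(** Two strictly increasing lists with the same elements are equal. *)
Lemma val_enum_vint n p q : (q <= n)%N ->
  map val (enum (@vint n p.+1 q)) = iota p (q - p).
Proof.
move=> qn; rewrite /enum_mem -enumT /=.
rewrite (eq_filter (a2 := (fun i => p <= i < q)%N \o val)); last first.
  by move=> i; rewrite /= inE.
rewrite -filter_map val_enum_ord.
apply: (irr_sorted_eq ltn_trans ltnn).
- by apply: sorted_filter; [exact: ltn_trans|exact: iota_ltn_sorted].
- exact: iota_ltn_sorted.
- by move=> i; rewrite mem_filter !mem_iota; lia.
Qed.

Lemma card_vint n p q : (q <= n)%N -> #|@vint n p.+1 q| = (q - p)%N.
Proof. by move=> qn; rewrite cardE -(size_map val) val_enum_vint// size_iota. Qed.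

Lemma enum_val_vint n p q (i : 'I_#|@vint n p.+1 q|) : (q <= n)%N ->
  enum_val i = (p + i)%N :> nat.
Proof.
move=> qn; have ilt : (i < q - p)%N by rewrite -(card_vint p qn).
rewrite (enum_val_nth (enum_default i)) -(nth_map _ 0%N val) -?cardE//.
by rewrite val_enum_vint// nth_iota.
Qed.

Definition diag_entries n (A : 'M[R]_n.+1) : nat -> R := fun i => A (inord i) (inord i).
Definition offdiag_entries n (A : 'M[R]_n.+1) : nat -> R :=
  fun i => A (inord i) (inord i.+1).

Lemma ZG_tridiag n (A : 'M[R]_n.+1) (i j : 'I_n.+1) : ZG A ->
  A i j = tridiag (diag_entries A) (offdiag_entries A) i j.
Proof.
move=> [At A0]; rewrite /tridiag /diag_entries /offdiag_entries.
case: eqP => [ij|ij]; first by rewrite inord_val; congr (A _ _); apply/val_inj.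
case: eqP => [ji|ji].
  by rewrite inord_val -ji inord_val.
case: eqP => [ij'|ij'].
  by rewrite -ij' !inord_val -[in LHS]At mxE.
apply: A0; rewrite /edge; apply/negP => /andP[]; lia.
Qed.

Lemma det_psubmx_vint n p q (A : 'M[R]_n.+1) : ZG A -> (q <= n.+1)%N ->
  \det (psubmx (vint p.+1 q) A) =
  continuant (q - p) (nshift p (diag_entries A)) (nshift p (offdiag_entries A)).
Proof.
move=> ZA qn; rewrite -det_tridiag.
apply: det_nat_entries => [|i j]; first exact: card_vint.
by rewrite mxE ZG_tridiag// !enum_val_vint// /tridiag /nshift !eqn_add2l -!addnS !eqn_add2l.
Qed.

Lemma det_ZG n (A : 'M[R]_n.+1) : ZG A ->
  \det A = continuant n.+1 (diag_entries A) (offdiag_entries A).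
Proof.
move=> ZA; rewrite -det_tridiag.
by apply: det_nat_entries => // i j; exact: ZG_tridiag.
Qed.

End tridiagonal.

(** * Positive definite matrices *)

Section positive_definite.
Context {R : realType}.

Definition qform n (A : 'M[R]_n) (u v : 'cV[R]_n) : R := (u^T *m A *m v) ord0 ord0.

Definition posdef n (A : 'M[R]_n) := forall v : 'cV[R]_n, v != 0 -> 0 < qform A v v.

Lemma qformE n (A : 'M[R]_n) u v :
  qform A u v = \sum_i \sum_j A i j * (u i ord0 * v j ord0).
Proof.
rewrite /qform -mulmxA mxE; apply: eq_bigr => i _; rewrite !mxE big_distrr/=.
by apply: eq_bigr => j _; ring.
Qed.

Lemma qformD n (A B : 'M[R]_n) u v : qform (A + B) u v = qform A u v + qform B u v.
Proof. by rewrite /qform mulmxDr mulmxDl mxE. Qed.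

Lemma qformZ n c (A : 'M[R]_n) u v : qform (c *: A) u v = c * qform A u v.
Proof. by rewrite /qform -scalemxAr -scalemxAl mxE. Qed.

Lemma qform1 n (v : 'cV[R]_n) : qform 1%:M v v = \sum_i v i ord0 ^+ 2.
Proof.
by rewrite /qform mulmx1 mxE; apply: eq_bigr => i _; rewrite !mxE expr2.
Qed.

Lemma qform1_gt0 n (v : 'cV[R]_n) : v != 0 -> 0 < qform 1%:M v v.
Proof.
move=> v0; rewrite qform1 lt_neqAle sumr_ge0 ?andbT; last by move=> i _; exact: sqr_ge0.
apply: contraNneq v0 => /esym/eqP; rewrite psumr_eq0; last by move=> i _; exact: sqr_ge0.
move=> /allP v0; apply/eqP/matrixP => i j; rewrite ord1 mxE.
by apply/eqP; rewrite -sqrf_eq0; exact: (v0 i (mem_index_enum i)).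
Qed.

Lemma posdef_unit n (A : 'M[R]_n) : posdef A -> A \in unitmx.
Proof.
move=> pA; rewrite -unitmx_tr unitmxE unitfE; apply/negP => /eqP/eqP/det0P[v v0 vA].
have := pA v^T; rewrite trmx_eq0 => /(_ v0).
rewrite /qform -mulmxA (_ : A *m v^T = 0) ?mulmx0 ?mxE ?ltxx//.
by rewrite -[A]trmxK -trmx_mul vA trmx0.
Qed.

(** On the segment from the identity to A the determinant is a polynomial without
    zeros, equal to 1 at the identity; the intermediate value theorem concludes. *)
Lemma posdef_det_gt0 n (A : 'M[R]_n) : posdef A -> 0 < \det A.
Proof.
move=> pA.
pose p : {poly R} := \det (\matrix_(i, j) (((1%:M : 'M[R]_n) i j)%:P + 'X * ((A - 1%:M) i j)%:P)).
have pE t : p.[t] = \det (1%:M + t *: (A - 1%:M)).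
  rewrite -horner_evalE -det_map_mx; congr (\det _); apply/matrixP => i j.
  rewrite [LHS]mxE [X in _ X = _]mxE /= /horner_eval !hornerE [RHS]mxE.
  by congr (_ + _); rewrite [RHS]mxE.
rewrite ltNge; apply/negP => dA.
have p0 : 0 <= p.[0] by rewrite pE scale0r addr0 det1.
have p1 : p.[1] <= 0 by rewrite pE scale1r addrC subrK.
have [|t] := @poly_ivt R (- p) 0 1 ler01.
  by rewrite !hornerN oppr_le0 p0 oppr_ge0.
move=> /andP[t0 t1]; rewrite rootN rootE pE => /eqP dt.
have : posdef (1%:M + t *: (A - 1%:M)).
  move=> v v0; rewrite (_ : _ + _ = (1 - t) *: 1%:M + t *: A); last first.
    by rewrite scalerBl scale1r scalerBr addrCA addrC -addrA addrC.
  rewrite qformD !qformZ.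
  have [->|tn0] := eqVneq t 0.
    by rewrite subr0 mul1r mul0r addr0 qform1_gt0.
  apply: ltr_wpDl; first by rewrite mulr_ge0 ?subr_ge0// ltW// qform1_gt0.
  by rewrite mulr_gt0 ?pA// lt_neqAle eq_sym tn0.
by move=> /posdef_unit; rewrite unitmxE dt unitr0.
Qed.

Lemma posdef_mxsub m n (f : 'I_m -> 'I_n) (A : 'M[R]_n) :
  injective f -> posdef A -> posdef (mxsub f f A).
Proof.
move=> fi pA v v0.
pose P : 'M[R]_(n, m) := \matrix_(i, j) (i == f j)%:R.
have PAP : mxsub f f A = P^T *m A *m P.
  apply/matrixP => i j; rewrite !mxE (bigD1 (f j))//= big1 ?addr0; last first.
    by move=> k kj; rewrite [P _ _]mxE (negbTE kj) mulr0.
  rewrite [P _ _]mxE eqxx mulr1 mxE (bigD1 (f i))//= big1 ?addr0; last first.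
    by move=> k ki; rewrite !mxE (negbTE ki) mul0r.
  by rewrite !mxE eqxx mul1r.
have PP : P^T *m P = 1%:M.
  apply/matrixP => i j; rewrite !mxE (bigD1 (f j))//= big1 ?addr0; last first.
    by move=> k kj; rewrite [P _ j]mxE (negbTE kj) mulr0.
  by rewrite !mxE eqxx mulr1 (inj_eq fi) eq_sym.
have Pv0 : P *m v != 0.
  apply: contraNneq v0 => Pv; apply/eqP.
  by rewrite -(mul1mx v) -PP -mulmxA Pv mulmx0.
by have := pA _ Pv0; rewrite /qform trmx_mul PAP !mulmxA.
Qed.

Lemma posdef_psubmx n (I : {set 'I_n}) (A : 'M[R]_n) : posdef A -> posdef (psubmx I A).
Proof. by apply: posdef_mxsub; exact: enum_val_inj. Qed.

Lemma PG_positive_minors n M (y : 'M[R]_n.+1) : (M <= n)%N -> PG y ->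
  positive_minors M n (diag_entries y) (offdiag_entries y).
Proof.
move=> Mn [Zy py]; have minor_gt0 p q : (q <= n.+1)%N ->
    0 < continuant (q - p) (nshift p (diag_entries y)) (nshift p (offdiag_entries y)).
  by move=> qn; rewrite -det_psubmx_vint//; apply/posdef_det_gt0/posdef_psubmx.
split => [i iM||i /andP[_ ik]].
- by apply: (minor_gt0 0%N i.+1); rewrite ltnS (leq_trans (ltnW iM)).
- exact: (minor_gt0 0%N n.+1).
- exact: minor_gt0.
Qed.

Section bilinear.
Variables (n : nat) (A : 'M[R]_n).
Implicit Types u v w : 'cV[R]_n.

Lemma qformDl u v w : qform A (u + v) w = qform A u w + qform A v w.
Proof. by rewrite /qform linearD/= !mulmxDl mxE. Qed.

Lemma qformDr u v w : qform A w (u + v) = qform A w u + qform A w v.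
Proof. by rewrite /qform mulmxDr mxE. Qed.

Lemma qformZl c u w : qform A (c *: u) w = c * qform A u w.
Proof. by rewrite /qform linearZ/= -!scalemxAl mxE. Qed.

Lemma qformZr c u w : qform A w (c *: u) = c * qform A w u.
Proof. by rewrite /qform -scalemxAr mxE. Qed.

Lemma qform_delta i j : qform A (delta_mx i ord0) (delta_mx j ord0) = A i j.
Proof.
by rewrite /qform trmx_delta -rowE -colE !mxE.
Qed.

Lemma qformC u v : A^T = A -> qform A u v = qform A v u.
Proof.
move=> At; rewrite !qformE exchange_big; apply: eq_bigr => i _.
by apply: eq_bigr => j _; rewrite -[in LHS]At mxE (mulrC (v _ _)).
Qed.

End bilinear.

Lemma posdef_ge0 n (A : 'M[R]_n) v : posdef A -> 0 <= qform A v v.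
Proof.
move=> pA; have [->|v0] := eqVneq v 0; last by rewrite ltW// pA.
by rewrite /qform mulmx0 mxE.
Qed.

Lemma posdef_cauchy_schwarz n (A : 'M[R]_n) (u v : 'cV[R]_n) : A^T = A -> posdef A ->
  qform A u v ^+ 2 <= qform A u u * qform A v v.
Proof.
move=> At pA; have [->|u0] := eqVneq u 0.
  by rewrite -(scale0r 0) !qformZl !mul0r expr0n.
have a0 := pA _ u0; set a := qform A u u in a0 *; set b := qform A u v.
have := posdef_ge0 (a *: v - b *: u) pA.
rewrite -scaleNr qformDl !qformDr !qformZl !qformZr (qformC v u At) -/a -/b.
set c := qform A v v; rewrite (_ : _ + _ = a * (a * c - b ^+ 2)); last by ring.
by rewrite pmulr_rge0// subr_ge0.
Qed.

(** Cauchy-Schwarz for the form A, applied to v and to the vector u with A u = e_i. *)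
Lemma posdef_coord_bound n (A : 'M[R]_n) (v : 'cV[R]_n) i : A^T = A -> posdef A ->
  v i ord0 ^+ 2 <= `|invmx A i i| * qform A v v.
Proof.
move=> At pA; have uA := posdef_unit pA.
pose u := invmx A *m delta_mx i ord0 : 'cV[R]_n.
have iAt : (invmx A)^T = invmx A by rewrite trmx_inv At.
have uv : qform A u v = v i ord0.
  by rewrite /qform /u trmx_mul iAt -(mulmxA _ (invmx A)) mulVmx// mulmx1 trmx_delta -rowE mxE.
have uu : qform A u u = invmx A i i.
  by rewrite /qform /u trmx_mul iAt -(mulmxA _ (invmx A)) mulVmx// mulmx1 mulmxA
    trmx_delta -rowE -colE !mxE.
rewrite -uv -uu (le_trans (posdef_cauchy_schwarz _ _ At pA))//.
by rewrite ler_wpM2r ?ler_norm ?posdef_ge0.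
Qed.

Lemma ZG_lincomb n (y z : 'M[R]_n) c d : ZG y -> ZG z -> ZG (c *: y + d *: z).
Proof.
move=> [yt y0] [zt z0]; split; first by rewrite linearD/= !linearZ/= yt zt.
by move=> i j ij; rewrite !mxE y0// z0// !mulr0 addr0.
Qed.

(** The bound on the coordinates of v gives |z(v, v)| <= C y(v, v) with an explicit
    C, so that every direction z is absorbed by a multiple of y. This one fact
    provides both the openness of P_G and the domination of the moments. *)
Lemma PG_absorbs n (y z : 'M[R]_n) : PG y -> ZG z ->
  exists2 c, 0 < c & PG (c *: y - z) /\ PG (c *: y + z).
Proof.
move=> [Zy py] Zz; have [yt _] := Zy.
pose C := \sum_i \sum_j `|z i j| * (`|invmx y i i| + `|invmx y j j|).
have bound (v : 'cV[R]_n) : `|qform z v v| <= C * qform y v v.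
  rewrite qformE (le_trans (ler_norm_sum _ _ _))// /C mulr_suml ler_sum// => i _.
  rewrite (le_trans (ler_norm_sum _ _ _))// mulr_suml ler_sum// => j _.
  rewrite normrM -mulrA ler_wpM2l// mulrDl.
  have := posdef_coord_bound v i yt py; have := posdef_coord_bound v j yt py.
  move: (v i ord0) (v j ord0) (`|invmx y i i| * _) (`|invmx y j j| * _) => a b p q hq hp.
  have := sqr_ge0 (a - b); have := sqr_ge0 (a + b).
  have := sqr_ge0 a; have := sqr_ge0 b.
  by rewrite ler_norml; nra.
have C0 : 0 <= C.
  by apply: sumr_ge0 => i _; apply: sumr_ge0 => j _; rewrite mulr_ge0// addr_ge0.
exists (C + 1); first by rewrite ltr_wpDl.
have pos e : `|e| = 1 -> PG ((C + 1) *: y + e *: z).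
  move=> e1; split; first exact: ZG_lincomb.
  move=> v v0; rewrite -/(qform _ _ _) qformD !qformZ mulrDl mul1r.
  have := bound v; have := py v v0; rewrite -/(qform _ _ _) => q0 qz.
  have : `|e * qform z v v| <= C * qform y v v by rewrite normrM e1 mul1r.
  by rewrite ler_norml => /andP[]; lra.
split; first by rewrite -scaleN1r; apply: pos; rewrite normrN1.
by rewrite -[z in _ + z]scale1r; apply: pos; rewrite normr1.
Qed.

Lemma PG_lincomb n (y z : 'M[R]_n) c d : PG y -> PG z -> 0 <= c -> 0 < d ->
  PG (c *: y + d *: z).
Proof.
move=> [Zy py] [Zz pz] c0 d0; split; first exact: ZG_lincomb.
move=> v v0; rewrite -/(qform _ _ _) qformD !qformZ ltr_wpDl//.
  by rewrite mulr_ge0// ltW// py.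
by rewrite mulr_gt0// pz.
Qed.

End positive_definite.

(** * The dual cone in coordinates *)

Section dual_cone.
Context {R : realType}.
Implicit Types (a b t e : nat -> R) (k : nat).

Definition lin_pairing k a b t e : R :=
  \sum_(0 <= i < k.+1) a i * t i + 2 * \sum_(0 <= i < k) b i * e i.

Lemma sum_tridiag k a b :
  \sum_(i < k.+1) \sum_(j < k.+1) tridiag a b i j =
  \sum_(0 <= i < k.+1) a i + 2 * \sum_(0 <= i < k) b i.
Proof.
elim: k a b => [|k IH] a b.
  by rewrite !big_ord1 big_nat1 big_geq// mulr0 addr0.
rewrite big_ord_recl (eq_bigr (fun i : 'I_k.+1 => tridiag a b i.+1 0 +
   \sum_(j < k.+1) tridiag (a \o S) (b \o S) i j)); last first.
  by move=> i _; rewrite big_ord_recl.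
rewrite big_split/= IH [\sum_(0 <= i < k.+2) _]big_nat_recl//.
rewrite [\sum_(0 <= i < k.+1) b _]big_nat_recl//.
rewrite 2!big_ord_recl big1 ?addr0; last by move=> i _.
by rewrite /tridiag/=; ring.
Qed.

(** Completing the square at vertex 0 turns y into its Schur complement. *)
Lemma lin_pairing_elim k a b t e : a 0%N != 0 ->
  lin_pairing k.+1 a b t e =
  a 0%N * t 0%N + 2 * (b 0%N * e 0%N) + b 0%N ^+ 2 / a 0%N * t 1%N +
  lin_pairing k (eliminate a b) (b \o S) (t \o S) (e \o S).
Proof.
move=> a0; rewrite /lin_pairing !big_nat_recl//=.
by field.
Qed.

(** The cone Q_G in coordinates, see QG_in_dual_cone. *)
Definition in_dual_cone k t e :=
  (forall i, (i <= k)%N -> 0 < t i) /\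
  (forall i, (i < k)%N -> 0 < t i * t i.+1 - e i ^+ 2).

(** At each elimination step the leftover
    a_0 t_0 + 2 b_0 e_0 + (b_0^2 / a_0) t_1 is nonnegative, since its
    product with a_0 t_1 is a_0^2 (t_0 t_1 - e_0^2) + (b_0 t_1 + a_0 e_0)^2. *)
Lemma lin_pairing_ge0 k a b t e : positive_minors k k a b ->
  in_dual_cone k t e -> 0 <= lin_pairing k a b t e.
Proof.
elim: k a b t e => [|k IH] a b t e pos [t0 te0].
  have [_ a0 _] := pos; rewrite /lin_pairing big_nat1 big_geq// mulr0 addr0.
  by rewrite continuant1 in a0; rewrite mulr_ge0 ?t0 ?ltW// t0.
have [a0 pos'] := positive_minors_left pos.
rewrite lin_pairing_elim ?gt_eqF// addr_ge0//; last first.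
  by apply: IH => //; split => i ik; [exact: t0|exact: te0].
rewrite -(pmulr_rge0 _ (t0 1%N isT)) -(pmulr_rge0 _ a0).
rewrite [leRHS](_ : _ = a 0%N ^+ 2 * (t 0%N * t 1%N - e 0%N ^+ 2) +
   (b 0%N * t 1%N + a 0%N * e 0%N) ^+ 2); last by field; rewrite gt_eqF.
by rewrite addr_ge0 ?sqr_ge0// mulr_ge0 ?sqr_ge0// ltW// te0.
Qed.

Lemma common_radius k (P : nat -> R -> Prop) :
  (forall i, (i < k)%N -> exists2 d, 0 < d & forall c, 0 < c <= d -> P i c) ->
  exists2 d, 0 < d & forall i, (i < k)%N -> P i d.
Proof.
move=> H; suff [d d0 Hd] : exists2 d, 0 < d &
    forall i, (i < k)%N -> forall c, 0 < c <= d -> P i c.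
  by exists d => // i ik; apply: (Hd i ik); rewrite d0 lexx.
elim: k H => [|k IH] H; first by exists 1.
have [d d0 Hd] := IH (fun i ik => H i (ltnW ik)).
have [d' d'0 Hd'] := H k (ltnSn k).
exists (Num.min d d'); first by rewrite lt_min d0.
move=> i; rewrite ltnS leq_eqVlt => /orP[/eqP ->|ik] c /andP[c0];
  rewrite le_min => /andP[cd cd'].
- by apply: Hd'; rewrite c0.
- by apply: Hd => //; rewrite c0.
Qed.

Lemma in_dual_cone_open k t e : in_dual_cone k t e ->
  exists2 d, 0 < d & in_dual_cone k (fun i => t i - d) e.
Proof.
move=> [t0 te0].
have [|d d0 Hd] := @common_radius k.+1 (fun i d => 0 < t i - d /\
    ((i < k)%N -> 0 < (t i - d) * (t i.+1 - d) - e i ^+ 2)).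
  move=> i; rewrite ltnS => ik; have ti := t0 _ ik.
  have [ik'|ki] := ltnP i k; last first.
    exists (t i / 2); first by rewrite divr_gt0.
    by move=> c /andP[c0 cd]; split => //; lra.
  have tS := t0 _ ik'; have m0 := te0 _ ik'.
  (* the minor drops by d (t_i + t_{i+1}) - d^2, less than half of it for this d *)
  exists (Num.min (t i / 2) ((t i * t i.+1 - e i ^+ 2) / (2 * (t i + t i.+1)))).
    by rewrite lt_min !divr_gt0// mulr_gt0// addr_gt0.
  move=> c /andP[c0]; rewrite le_min => /andP[c1 c2]; split; first by lra.
  move=> _; move: c2; rewrite ler_pdivlMr; last by rewrite mulr_gt0// addr_gt0.
  by have := mulr_gt0 c0 ti; have := mulr_gt0 c0 tS; have := sqr_ge0 c; nra.
by exists d => //; split => i ik; [have [] := Hd i ik|have [_] := Hd i (ltnW ik); exact].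
Qed.

Section vertices.
Variable k : nat.
Implicit Types (eta : IG R k.+1) (y : 'M[R]_k.+1).

Definition diag_coord eta : nat -> R := nth 0 eta.1.
Definition edge_coord eta : nat -> R := nth 0 eta.2.

Lemma inc_mxE eta (i j : 'I_k.+1) :
  inc_mx eta i j = tridiag (diag_coord eta) (edge_coord eta) i j.
Proof.
rewrite mxE /tridiag -val_eqE/=; case: eqP => [_|ij]; first by rewrite (tnth_nth 0).
rewrite /edge; case: eqP => [->|ij1].
  by rewrite ifT ?(minn_idPl (leqnSn _))//; lia.
case: eqP => [->|ij2]; first by rewrite ifT ?(minn_idPr (leqnSn _))//; lia.
by rewrite ifF//; apply/negbTE/negP => /andP[]; lia.
Qed.

Lemma inc_mx_ZG eta : ZG (inc_mx eta).
Proof.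
split; last by move=> i j ij; rewrite mxE (negbTE ij); case: eqP ij => // ->; rewrite /edge leqnSn.
apply/matrixP => i j; rewrite mxE !inc_mxE /tridiag eq_sym.
case: eqP => [->//|ij]; case: eqP => [ij1|_]; case: eqP => [ij2|_] //.
by move: ij1; rewrite ij2; lia.
Qed.

Lemma diag_entries_inc_mx eta i : (i <= k)%N ->
  diag_entries (inc_mx eta) i = diag_coord eta i.
Proof. by move=> ik; rewrite /diag_entries inc_mxE /tridiag eqxx inordK. Qed.

Lemma offdiag_entries_inc_mx eta i : (i < k)%N ->
  offdiag_entries (inc_mx eta) i = edge_coord eta i.
Proof.
move=> ik; rewrite /offdiag_entries inc_mxE /tridiag !inordK//; last exact: ltnW.
by rewrite (ltn_eqF (ltnSn i)) eqxx.
Qed.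

Lemma pairingE eta y : ZG y -> pairing eta y =
  lin_pairing k (diag_entries y) (offdiag_entries y) (diag_coord eta) (edge_coord eta).
Proof.
move=> Zy; rewrite /lin_pairing -(sum_tridiag k (fun i => _ * _) (fun i => _ * _)).
apply: eq_bigr => i _; rewrite big_mkcond/=; apply: eq_bigr => j _.
rewrite (ZG_tridiag _ _ Zy) inc_mxE /tridiag /edge.
case: eqP => [->|ij]; first by rewrite leqnSn.
case: eqP => [->|ij1]; first by rewrite ifT//; lia.
case: eqP => [->|ij2]; first by rewrite ifT//; lia.
by rewrite mul0r if_same.
Qed.

Lemma idiagE eta i : (i <= k)%N -> idiag eta i.+1 = diag_coord eta i.
Proof.
move=> ik; rewrite /idiag /vcoord; case: insubP => [j _ ji|]; last by rewrite ltnS ik.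
by rewrite inc_mxE /tridiag eqxx ji.
Qed.

Lemma iminorE eta i : (i < k)%N -> iminor eta i.+1 =
  diag_coord eta i * diag_coord eta i.+1 - edge_coord eta i ^+ 2.
Proof.
move=> ik; rewrite /iminor det_psubmx_vint; [|exact: inc_mx_ZG|by []].
rewrite -addn2 addKn continuantSS continuant1 /= mulr1 /nshift /= addn0 addn1.
by rewrite !diag_entries_inc_mx ?offdiag_entries_inc_mx// ltnW.
Qed.

End vertices.
End dual_cone.

(** * The closure of the cone P_G *)

Section closure_cone.
Context {R : realType}.

Definition entry_form m n (I : finType) (f : I -> 'I_m) (g : I -> 'I_n) (c : I -> R)
  (y : 'M[R]_(m, n)) : R := \sum_i y (f i) (g i) * c i.

Lemma continuous_sumr (T : topologicalType) (I : Type) (r : seq I) (F : I -> T -> R) :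
  (forall i, continuous (F i)) -> continuous (fun x => \sum_(i <- r) F i x).
Proof.
move=> cF; elim: r => [|i r IH].
  rewrite (_ : (fun _ => _) = cst 0); first exact: cst_continuous.
  by apply/funext => y; rewrite big_nil.
rewrite (_ : (fun _ => _) = fun y : T => F i y + \sum_(i <- r) F i y); last first.
  by apply/funext => y; rewrite big_cons.
by move=> y; apply: cvgD; [exact: cF|exact: IH].
Qed.

Lemma continuous_mulr_cst (T : topologicalType) (F : T -> R) (c : R) :
  continuous F -> continuous (fun x => F x * c).
Proof. by move=> cF y; apply: cvgM; [exact: cF|exact: cvg_cst]. Qed.

Lemma continuous_entry_form m n (I : finType) (f : I -> 'I_m) (g : I -> 'I_n) c :
  continuous (entry_form f g c : 'M[R]_(m, n) -> R).
Proof.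
apply: continuous_sumr => i; apply: continuous_mulr_cst.
exact: coord_continuous.
Qed.

Lemma continuous_subr (T : topologicalType) (F G : T -> R) :
  continuous F -> continuous G -> continuous (fun x => F x - G x).
Proof. by move=> cF cG y; apply: cvgB; [exact: cF|exact: cG]. Qed.

Lemma continuous_addr (T : topologicalType) (F G : T -> R) :
  continuous F -> continuous G -> continuous (fun x => F x + G x).
Proof. by move=> cF cG y; apply: cvgD; [exact: cF|exact: cG]. Qed.

Variable n : nat.
Implicit Types (y : 'M[R]_n).

Lemma closure_PG_ge0 (L : 'M[R]_n -> R) : continuous L ->
  (forall y, PG y -> 0 <= L y) -> forall y, closure PG y -> 0 <= L y.
Proof.
move=> cL L0 y cy.
have cA : closed (L @^-1` [set x | 0 <= x]).
  by apply: closed_comp.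
by have := closure_subset L0 cy; rewrite -(closure_id _).1.
Qed.

Lemma closure_PG_eq0 (L : 'M[R]_n -> R) : continuous L ->
  (forall y, PG y -> L y = 0) -> forall y, closure PG y -> L y = 0.
Proof.
move=> cL L0 y cy; apply/eqP; rewrite eq_le; apply/andP; split.
  rewrite -oppr_ge0; apply: (closure_PG_ge0 (L := fun y => - L y)) cy => [|z pz].
    rewrite (_ : (fun y => - L y) = fun y => L y * -1).
      exact: continuous_mulr_cst.
    by apply/funext => z; rewrite mulrN1.
  by rewrite L0// oppr0.
by apply: (closure_PG_ge0 cL) cy => z pz; rewrite L0.
Qed.

Lemma closure_PG_ZG y : closure PG y -> ZG y.
Proof.
move=> cy; split.
  apply/matrixP => i j; rewrite mxE; apply/eqP; rewrite -subr_eq0; apply/eqP.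
  apply: (closure_PG_eq0 (L := fun y => y j i - y i j)) cy => [|z [[zt _] _]].
    by apply: continuous_subr; exact: coord_continuous.
  by rewrite -{1}zt mxE subrr.
move=> i j ij; apply: (closure_PG_eq0 (L := fun y => y i j)) cy => [|z [[_ z0] _]].
  exact: coord_continuous.
exact: z0.
Qed.

Lemma closure_PG_qform y v : closure PG y -> 0 <= qform y v v.
Proof.
apply: (closure_PG_ge0 (L := fun y => qform y v v)) => [|z [Zz pz]]; last exact: posdef_ge0.
rewrite (_ : (fun y => _) = entry_form (fun p : 'I_n * 'I_n => p.1) (fun p => p.2)
  (fun p => v p.1 ord0 * v p.2 ord0)); first exact: continuous_entry_form.
by apply/funext => z; rewrite qformE pair_bigA.
Qed.

Lemma closure_PG_diag y i : closure PG y -> 0 <= y i i.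
Proof. by move=> /(closure_PG_qform (delta_mx i ord0)); rewrite qform_delta. Qed.

(** A positive semidefinite matrix with zero diagonal vanishes, as its 2 x 2 forms
    show. *)
Lemma closure_PG_trace_gt0 y : closure PG y -> y != 0 -> 0 < \tr y.
Proof.
move=> cy y0; rewrite lt_neqAle sumr_ge0 ?andbT; last first.
  by move=> i _; exact: closure_PG_diag.
apply: contraNneq y0 => /esym/eqP; rewrite psumr_eq0; last first.
  by move=> i _; exact: closure_PG_diag.
move=> /allP d0; have d0' i : y i i = 0.
  by apply/eqP; exact: (d0 i (mem_index_enum i)).
have [sy _] := closure_PG_ZG cy.
apply/eqP/matrixP => i j; rewrite mxE.
have H c := closure_PG_qform (delta_mx i ord0 + c *: delta_mx j ord0) cy.
have qE c : qform y (delta_mx i ord0 + c *: delta_mx j ord0)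
   (delta_mx i ord0 + c *: delta_mx j ord0) = 2 * c * y i j.
  rewrite qformDl !qformDr !qformZl !qformZr !qform_delta !d0'.
  by rewrite -[in y j i]sy mxE; ring.
by have := H 1; have := H (-1); rewrite !qE; lra.
Qed.

(** Adding a small multiple of the identity makes the form positive definite. *)
Lemma psd_closure_PG y : ZG y -> (forall v, 0 <= qform y v v) -> closure PG y.
Proof.
move=> Zy py B /nbhs_ballP[e /= e0 yB].
exists (y + (e / 2) *: 1%:M); split; last first.
  apply: yB; split => // i j; rewrite /ball /= !mxE opprD addNKr normrN.
  case: eqP => _; rewrite ?mulr1 ?mulr0 ?normr0// gtr0_norm; lra.
split.
  rewrite -[y]scale1r; apply: ZG_lincomb => //; split; first exact: trmx1.
  by move=> i j; rewrite mxE; case: eqP => // ->; rewrite /edge leqnSn.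
move=> v v0; rewrite -/(qform _ _ _) qformD qformZ ltr_wpDl//.
by rewrite mulr_gt0 ?qform1_gt0// divr_gt0.
Qed.

End closure_cone.

Section dual_cone_characterization.
Context {R : realType} {k : nat}.
Implicit Types (eta : IG R k.+1) (y : 'M[R]_k.+1).

Lemma pairing_rank1 eta (u : 'cV[R]_k.+1) :
  pairing eta (u *m u^T) = qform (inc_mx eta) u u.
Proof.
rewrite qformE; apply: eq_bigr => i _; rewrite big_mkcond/=; apply: eq_bigr => j _.
case: ifPn => ij; last first.
  by have [_ ->//] := inc_mx_ZG eta; rewrite mul0r.
by rewrite mxE big_ord1 mxE mulrC.
Qed.

(** Rank one forms supported on an edge belong to Z_G; they are the test matrices
    that detect the 2 x 2 minors of eta. *)
Lemma edge_rank1_closure (i j : 'I_k.+1) (c d : R) : edge i j ->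
  let u := c *: delta_mx i ord0 + d *: delta_mx j ord0 : 'cV[R]_k.+1 in
  closure PG (u *m u^T).
Proof.
move=> ij u; apply: psd_closure_PG; last first.
  move=> v; rewrite /qform !mulmxA -mulmxA -[u^T *m v]trmxK trmx_mul trmxK.
  rewrite mxE big_ord1 [X in _ * X]mxE -expr2; exact: sqr_ge0.
split; first by rewrite trmx_mul trmxK.
have u0 l : l != i -> l != j -> u l ord0 = 0.
  by move=> li lj; rewrite !mxE (negbTE li) (negbTE lj) !mulr0 addr0.
move=> l m lm; rewrite mxE big_ord1 [X in _ * X]mxE.
have [li|li] := eqVneq l i; have [lj|lj] := eqVneq l j;
  have [mi|mi] := eqVneq m i; have [mj|mj] := eqVneq m j;
  rewrite ?(u0 _ li lj) ?(u0 _ mi mj) ?mulr0 ?mul0r//; subst;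
  by move: lm ij; rewrite /edge ?leqnSn// andbC => /negbTE ->.
Qed.

Lemma QG_edge_form eta (i j : 'I_k.+1) (c d : R) : QG eta -> edge i j ->
  (c != 0) -> (i == j -> d = 0) ->
  0 < c ^+ 2 * inc_mx eta i i + 2 * c * d * inc_mx eta i j + d ^+ 2 * inc_mx eta j j.
Proof.
move=> Qeta ij c0 ijd.
pose u := c *: delta_mx i ord0 + d *: delta_mx j ord0 : 'cV[R]_k.+1.
have uu : u *m u^T != 0.
  apply/eqP => /matrixP /(_ i i); rewrite mxE big_ord1 [X in _ * X]mxE !mxE !eqxx.
  case: eqP => [/eqP/ijd ->|_]; rewrite ?mulr0 ?mul0r !mulr1 addr0 => /eqP;
    by rewrite mulf_eq0 orbb (negbTE c0).
have := Qeta _ (@edge_rank1_closure i j c d ij) uu; rewrite pairing_rank1.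
rewrite qformDl !qformDr !qformZl !qformZr !qform_delta.
have -> : inc_mx eta j i = inc_mx eta i j.
  by have [st _] := inc_mx_ZG eta; rewrite -{1}st mxE.
by congr (0 < _); ring.
Qed.

(** Rank one test matrices on single edges give the positivity of the minors.
    Conversely the pairing is nonnegative on P_G, hence on its closure; it is positive
    there because the conditions on eta are open: subtracting d from the diagonal of
    eta lowers the pairing with y by d tr(y), and tr(y) > 0. *)
Lemma QG_in_dual_cone eta :
  QG eta <-> in_dual_cone k (diag_coord eta) (edge_coord eta).
Proof.
split => [Qeta|Ceta y cy y0].
  have t0 i : (i <= k)%N -> 0 < diag_coord eta i.
    move=> ik; have ee : edge (inord i : 'I_k.+1) (inord i) by rewrite /edge leqnSn.
    have := QG_edge_form Qeta ee (oner_neq0 R) (fun=> erefl (0 : R)).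
    rewrite expr1n mul1r mulr0 mul0r addr0 expr0n mul0r addr0.
    by rewrite -/(diag_entries (inc_mx eta) i) diag_entries_inc_mx.
  split => // i ik.
  have ti := t0 i (ltnW ik).
  have [e0|e0] := eqVneq (edge_coord eta i) 0.
    by rewrite e0 expr0n subr0 mulr_gt0// t0.
  have ee : edge (inord i : 'I_k.+1) (inord i.+1).
    by rewrite /edge !inordK// ?leqnn ?andbT//; lia.
  (* the vector (e_i, - t_i) makes the form equal to t_i times the minor *)
  have := @QG_edge_form eta _ _ (edge_coord eta i) (- diag_coord eta i) Qeta ee e0.
  rewrite -/(diag_entries (inc_mx eta) i) -/(diag_entries (inc_mx eta) i.+1).
  rewrite -/(offdiag_entries (inc_mx eta) i) !diag_entries_inc_mx//; last exact: ltnW.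
  rewrite offdiag_entries_inc_mx//.
  set t := diag_coord eta i; set t' := diag_coord eta _; set e := edge_coord eta i.
  have -> : e ^+ 2 * t + 2 * e * - t * e + (- t) ^+ 2 * t' = t * (t * t' - e ^+ 2) by ring.
  rewrite pmulr_rgt0//; apply.
  by rewrite -val_eqE /= !inordK//; [rewrite (ltn_eqF (ltnSn i))|lia].
have [d d0 Cd] := in_dual_cone_open Ceta.
have Zy := closure_PG_ZG cy.
rewrite pairingE//.
pose L (y : 'M[R]_k.+1) := lin_pairing k (diag_entries y) (offdiag_entries y)
   (fun i => diag_coord eta i - d) (edge_coord eta).
have -> : lin_pairing k (diag_entries y) (offdiag_entries y) (diag_coord eta)
    (edge_coord eta) = d * \tr y + L y.
  rewrite /L /lin_pairing addrA; congr (_ + _).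
  rewrite /mxtrace mulr_sumr !big_mkord -big_split/=; apply: eq_bigr => i _.
  by rewrite /diag_entries inord_val; ring.
rewrite ltr_pwDl// ?mulr_gt0 ?closure_PG_trace_gt0//.
apply: (closure_PG_ge0 (L := L)) cy => [|z pz]; last first.
  by apply: lin_pairing_ge0 => //; exact: PG_positive_minors.
apply: continuous_addr.
  under eq_fun do rewrite big_mkord.
  exact: (@continuous_entry_form _ _ _ _ (fun i : 'I_k.+1 => inord i)
    (fun i => inord i) (fun i => diag_coord eta i - d)).
under eq_fun do rewrite mulrC big_mkord.
apply: continuous_mulr_cst.
exact: (@continuous_entry_form _ _ _ _ (fun i : 'I_k => inord i)
    (fun i => inord i.+1) (fun i => edge_coord eta i)).
Qed.

End dual_cone_characterization.

(** * The Wishart density as a path density *)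

Section wishart_density.
Context {R : realType} {k : nat}.
Implicit Types (eta : IG R k.+1) (y : 'M[R]_k.+1) (s : 'I_k.+1 -> R).

Lemma prod_powR (m n : nat) (x r : nat -> R) :
  (forall i, (m <= i < n)%N -> 0 < x i) ->
  \prod_(m <= i < n) x i `^ r i = expR (\sum_(m <= i < n) r i * ln (x i)).
Proof.
move=> x0; rewrite expR_sum; apply: eq_big_nat => i ij.
by rewrite /powR gt_eqF// x0.
Qed.

Lemma sum_vertex_exponent M (s u : nat -> R) : (M <= k)%N ->
  \sum_(0 <= i < k.+1) vertex_exponent M k s i * u i =
  \sum_(1 <= i < M.+1) (1 - s i.-1) * u i + \sum_(M <= i < k) (1 - s i.+1) * u i +
  (s M - 1) * u M.
Proof.
move=> Mk; have split_exponent : \sum_(0 <= i < k.+1) vertex_exponent M k s i * u i =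
    \sum_(0 <= i < k.+1) ((if (0 < i <= M)%N then (1 - s i.-1) * u i else 0) +
      (if (M <= i < k)%N then (1 - s i.+1) * u i else 0) +
      (if i == M then (s M - 1) * u M else 0)).
  apply: eq_bigr => i _; rewrite /vertex_exponent.
  by case: eqP => [->|_]; case: ifP => _; case: ifP => _; ring.
rewrite split_exponent !big_split/= -!big_mkcond/=; congr (_ + _ + _).
- rewrite (big_nat_widen 1 M.+1 k.+1)// (big_nat_widenl 1 0 k.+1)//.
  by apply: eq_bigl => i; lia.
- rewrite (big_nat_widen M k k.+1)// (big_nat_widenl M 0 k.+1)//.
  by apply: eq_bigl => i; lia.
- rewrite big_nat1_eq; case: ifP => //; lia.
Qed.

(** Bookkeeping of the exponents of the diagonal entries. The left side is read
    off the definitions of delta and phi, with u_i the logarithm of the i-th diagonal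
    entry; the case k = 0 is the separate value of phi on a path with one vertex. *)
Lemma vertex_exponent_identity M (s u : nat -> R) (sl sr : R) : (M <= k)%N ->
  (sl = if M is M'.+1 then s M' else 0) -> sr = (if (M < k)%N then s M.+1 else 0) ->
  - (\sum_(1 <= i < M) s i.-1 * u i + (sl - s M + sr) * u M +
     \sum_(M.+1 <= i < k) s i.+1 * u i) +
  (if k == 0%N then - u 0%N else \sum_(1 <= i < k) u i) =
  \sum_(0 <= i < k.+1) vertex_exponent M k s i * u i.
Proof.
move=> Mk -> ->; rewrite sum_vertex_exponent//.
under [X in _ = X + _ + _]eq_bigr do rewrite mulrBl mul1r.
under [X in _ = _ + X + _]eq_bigr do rewrite mulrBl mul1r.
rewrite !sumrB.
case: M Mk => [|M] Mk.
  rewrite ![\sum_(1 <= i < 0) _]big_geq//.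
  case: (posnP k) => [->|k0]; first by rewrite !big_geq//=; ring.
  by rewrite ![\sum_(0 <= i < k) _]big_ltn//; ring.
rewrite ![\sum_(1 <= i < M.+2) _]big_nat_recr//=.
rewrite gtn_eqF; last exact: leq_trans Mk.
case: (ltnP M.+1 k) => [Mk'|kM].
  rewrite ![\sum_(M.+1 <= i < k) _]big_ltn//.
  rewrite (@big_cat_nat _ _ _ M.+1 1 k)//=.
  rewrite ![\sum_(M.+1 <= i < k) _]big_ltn//.
  ring.
rewrite (_ : M.+1 = k); last by apply/eqP; rewrite eqn_leq Mk.
rewrite ![\sum_(k <= i < k) _]big_geq// ![\sum_(k.+1 <= i < k) _]big_geq//.
ring.
Qed.

Definition shape_seq s : nat -> R := fun i => vcoord s i.+1.

Definition wishart_density M s y eta : R :=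
  path_density k (vertex_exponent M k (shape_seq s)) (diag_entries y)
    (edge_exponent M (shape_seq s)) (offdiag_entries y)
    (diag_coord eta) (edge_coord eta).

(** All quantities are positive on the cone, so that powers become exponentials
    and products become sums of logarithms. *)
Lemma delta_phi_expR M s eta : (M <= k)%N ->
  in_dual_cone k (diag_coord eta) (edge_coord eta) ->
  let u i := ln (diag_coord eta i) in
  let v i := ln (diag_coord eta i * diag_coord eta i.+1 - edge_coord eta i ^+ 2) in
  delta M.+1 s eta * phi eta =
  expR (\sum_(0 <= i < k.+1) vertex_exponent M k (shape_seq s) i * u i +
        \sum_(0 <= i < k) edge_exponent M (shape_seq s) i * v i).
Proof.
move=> Mk [t0 m0] u v.
have minors (m n : nat) r : (n <= k)%N ->
    \prod_(m <= i < n) iminor eta i.+1 `^ r i = expR (\sum_(m <= i < n) r i * v i).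
  move=> nk; rewrite -prod_powR; last first.
    by move=> i /andP[_ ni]; exact: m0 (leq_trans ni nk).
  by apply: eq_big_nat => i /andP[_ ni]; rewrite iminorE// (leq_trans ni).
have diags (m n : nat) r : (n <= k.+1)%N ->
    \prod_(m <= i < n) idiag eta i.+1 `^ r i = expR (\sum_(m <= i < n) r i * u i).
  move=> nk; rewrite -prod_powR; last first.
    by move=> i /andP[_ ni]; exact: t0 (leq_trans ni nk).
  by apply: eq_big_nat => i /andP[_ ni]; rewrite idiagE// -ltnS (leq_trans ni).
have -> : delta M.+1 s eta = expR ((\sum_(0 <= i < M) shape_seq s i * v i +
    \sum_(M <= i < k) shape_seq s i.+1 * v i) -
   (\sum_(1 <= i < M) shape_seq s i.-1 * u i +
    ((if M is M'.+1 then shape_seq s M' else 0) - shape_seq s M +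
     (if (M < k)%N then shape_seq s M.+1 else 0)) * u M +
    \sum_(M.+1 <= i < k) shape_seq s i.+1 * u i)).
  have E1 : \prod_(1 <= i < M.+1) iminor eta i `^ vcoord s i =
      expR (\sum_(0 <= i < M) shape_seq s i * v i).
    by rewrite big_add1; exact: (minors 0%N M (shape_seq s)).
  have E2 : \prod_(M.+2 <= i < k.+2) iminor eta i.-1 `^ vcoord s i =
      expR (\sum_(M <= i < k) shape_seq s i.+1 * v i).
    by rewrite 2!big_add1; exact: (minors M k (fun i => shape_seq s i.+1)).
  have E3 : \prod_(2 <= i < M.+1) idiag eta i `^ vcoord s i.-1 =
      expR (\sum_(1 <= i < M) shape_seq s i.-1 * u i).
    rewrite big_add1 (diags 1%N M (vcoord s)); last exact: leqW.
    by congr expR; apply: eq_big_nat => -[].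
  have E4 : \prod_(M.+2 <= i < k.+1) idiag eta i `^ vcoord s i.+1 =
      expR (\sum_(M.+1 <= i < k) shape_seq s i.+1 * u i).
    by rewrite big_add1; exact: (diags M.+1 k (fun i => shape_seq s i.+1)).
  rewrite /delta E1 E2 E3 E4.
  rewrite idiagE// /powR gt_eqF ?t0// -!expRD -expRN -expRD; congr expR.
  have -> : vcoord s M.+1.-1 = if M is M'.+1 then shape_seq s M' else 0.
    by case: (M).
  suff -> : vcoord s M.+2 = if (M < k)%N then shape_seq s M.+1 else 0 by [].
  by case: ltnP => // kM; rewrite /vcoord insubN// -leqNgt.
have -> : phi eta = expR (- (3 / 2) * \sum_(0 <= i < k) v i +
    (if k == 0%N then - u 0%N else \sum_(1 <= i < k) u i)).
  rewrite /phi eqSS; case: eqVneq => [k0|k0].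
    have -> : \sum_(0 <= i < k) v i = 0 by rewrite big_geq// k0.
    rewrite mulr0 add0r idiagE// expRN.
    by rewrite /u lnK// posrE t0.
  have -> : \prod_(1 <= i < k.+1) iminor eta i `^ (- (3 / 2)) =
      expR (- (3 / 2) * \sum_(0 <= i < k) v i).
    by rewrite big_add1 mulr_sumr; exact: (minors 0%N k (fun=> - (3 / 2))).
  rewrite expRD; congr (_ * _); rewrite expR_sum big_add1.
  apply: eq_big_nat => i /andP[_ ik].
  by rewrite idiagE 1?ltnW// lnK// posrE t0// ltnW.
rewrite -expRD -(@vertex_exponent_identity M (shape_seq s) u _ _ Mk erefl erefl); congr expR.
have -> : \sum_(0 <= i < k) edge_exponent M (shape_seq s) i * v i =
  \sum_(0 <= i < M) shape_seq s i * v i +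
    \sum_(M <= i < k) shape_seq s i.+1 * v i - 3 / 2 * \sum_(0 <= i < k) v i.
  rewrite (@big_cat_nat _ _ _ M 0 k)//=.
  rewrite [X in _ = _ - _ * X](@big_cat_nat _ _ _ M 0 k)//=.
  rewrite (eq_big_nat _ _ (F2 := fun i => shape_seq s i * v i - 3 / 2 * v i)); last first.
    by move=> i /andP[_ iM]; rewrite /edge_exponent iM mulrBl.
  rewrite [X in _ + X = _](eq_big_nat _ _ (F2 := fun i => shape_seq s i.+1 * v i - 3 / 2 * v i)); last first.
    by move=> i /andP[Mi _]; rewrite /edge_exponent ltnNge Mi mulrBl.
  by rewrite !sumrB -!mulr_sumr; ring.
set B := (\sum_(1 <= i < M) _ + _ + _); set P := (if k == 0%N then _ else _).
ring.
Qed.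

Lemma wishart_density_expR M s y eta :
  in_dual_cone k (diag_coord eta) (edge_coord eta) ->
  let u i := ln (diag_coord eta i) in
  let v i := ln (diag_coord eta i * diag_coord eta i.+1 - edge_coord eta i ^+ 2) in
  wishart_density M s y eta = expR (- lin_pairing k (diag_entries y)
      (offdiag_entries y) (diag_coord eta) (edge_coord eta) +
    (\sum_(0 <= i < k.+1) vertex_exponent M k (shape_seq s) i * u i +
     \sum_(0 <= i < k) edge_exponent M (shape_seq s) i * v i)).
Proof.
move=> [t0 m0] u v; rewrite /wishart_density path_densityE.
rewrite (eq_bigr (fun i : 'I_k.+1 => expR (vertex_exponent M k (shape_seq s) i * u i -
    diag_entries y i * diag_coord eta i))); last first.
  move=> i _; have ti : 0 < diag_coord eta i by rewrite t0// -ltnS.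
  by rewrite /vertex_factor ti /powR gt_eqF// expRD.
rewrite [X in _ * X](eq_bigr (fun i : 'I_k => expR (edge_exponent M (shape_seq s) i * v i -
    2 * offdiag_entries y i * edge_coord eta i))); last first.
  move=> i _; have mi := m0 _ (ltn_ord i).
  by rewrite /edge_factor mi /powR gt_eqF// expRD.
rewrite -!expR_sum -expRD; congr expR.
rewrite !sumrB /lin_pairing !big_mkord.
have -> : \sum_(i < k) 2 * offdiag_entries y i * edge_coord eta i =
    2 * \sum_(i < k) offdiag_entries y i * edge_coord eta i.
  by rewrite mulr_sumr; apply: eq_bigr => i _; rewrite mulrA.
ring.
Qed.

Lemma wishart_density_notin M s y eta :
  ~ in_dual_cone k (diag_coord eta) (edge_coord eta) -> wishart_density M s y eta = 0.
Proof.
move=> nC; rewrite /wishart_density path_densityE.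
apply: contrapT => /eqP; rewrite mulf_eq0 negb_or => /andP[/prodf_neq0 tn0 /prodf_neq0 mn0].
apply: nC; split => i ik.
  have := tn0 (Ordinal (ik : (i < k.+1)%N)) isT; rewrite /vertex_factor/=.
  by case: ifP; rewrite ?eqxx.
have := mn0 (Ordinal ik) isT; rewrite /edge_factor/=.
by case: ifP; rewrite ?eqxx.
Qed.

Lemma wishart_funE M s y eta : (M <= k)%N -> ZG y -> QG eta ->
  wishart_fun M.+1 s y eta = wishart_density M s y eta.
Proof.
move=> Mk Zy /QG_in_dual_cone Ceta.
by rewrite wishart_density_expR// expRD -pairingE// -delta_phi_expR// mulrA.
Qed.

(** Changing y only changes the exponential factor. *)
Lemma wishart_density_tilt M s y y' eta : ZG y -> ZG y' ->
  wishart_density M s y' eta = expR (- pairing eta (y' - y)) * wishart_density M s y eta.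
Proof.
move=> Zy Zy'; have [Ceta|nC] := pselect (in_dual_cone k (diag_coord eta) (edge_coord eta)); last first.
  by rewrite !wishart_density_notin// mulr0.
rewrite !wishart_density_expR// -expRD -!pairingE//; congr expR.
have -> : pairing eta (y' - y) = pairing eta y' - pairing eta y.
  rewrite /pairing -sumrB; apply: eq_bigr => i _; rewrite -sumrB; apply: eq_bigr => j _.
  by rewrite !mxE mulrBl.
ring.
Qed.

End wishart_density.

(** * The Laplace transform of the Wishart law *)

Section density.
Local Open Scope ereal_scope.
Context d (T : measurableType d) (R : realType).
Variables (nu mu : {measure set T -> \bar R}) (h : T -> R).
Hypotheses (mh : measurable_fun setT h) (h0 : forall x, (0 <= h x)%R).
Hypothesis nuE : forall A, measurable A -> nu A = \int[mu]_(x in A) (h x)%:E.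

Import HBNNSimple.

(** By linearity from indicator functions. *)
Lemma nnsfun_integral_density (f : {nnsfun T >-> R}) :
  \int[nu]_x (f x)%:E = \int[mu]_x (f x * h x)%:E.
Proof.
transitivity (\int[mu]_x \sum_(r \in range f)
    (r * \1_(f @^-1` [set r]) x * h x)%:E); last first.
  by apply: eq_integral => x _; rewrite fsumEFin// -mulr_fsuml -fimfunE.
under eq_integral do rewrite fimfunE -fsumEFin//.
rewrite !ge0_integral_fsum//; last 4 first.
- by move=> r; apply/measurable_EFinP/measurable_funM => //; exact: measurable_funM.
- move=> r x _; rewrite lee_fin mulr_ge0//.
  by have := nnfun_muleindic_ge0 f r x; rewrite lee_fin.
- by move=> y; exact/measurable_EFinP/measurable_funM.
- by move=> y x _; rewrite nnfun_muleindic_ge0.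
apply: eq_fsbigr => r; rewrite inE => -[x _ <-].
have fx0 : (0 <= f x)%R by [].
under eq_integral do rewrite EFinM.
rewrite ge0_integralZl//.
  rewrite integral_indic// setIT nuE// integral_mkcond -ge0_integralZl//; last 2 first.
  - apply/(measurable_restrict _ _ measurableT) => //.
    by apply: measurable_funTS; exact/measurable_EFinP.
  - by move=> y _; rewrite patchE; case: ifP => //; rewrite lee_fin.
  apply: eq_integral => y _; rewrite patchE indicE.
  by case: ifP => _; rewrite ?mulr1 ?mulr0 ?mul0r ?mule0 -?EFinM.
by apply/measurable_EFinP.
Qed.

(** Monotone approximation by simple functions. *)
Lemma ge0_integral_density (g : T -> R) : measurable_fun setT g ->
  (forall x, (0 <= g x)%R) -> \int[nu]_x (g x)%:E = \int[mu]_x (g x * h x)%:E.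
Proof.
move=> mg g0.
have mg' : measurable_fun setT (EFin \o g) by exact/measurable_EFinP.
pose f_ := nnsfun_approx measurableT mg'.
have f_cvg x : (f_ n x)%:E @[n --> \oo] --> (g x)%:E.
  by apply: cvg_nnsfun_approx => // *; rewrite lee_fin.
transitivity (limn (fun n => \int[nu]_x (f_ n x)%:E)).
  rewrite -monotone_convergence//.
  - by apply: eq_integral => y _; apply/esym/cvg_lim => //; exact: f_cvg.
  - by move=> n; exact/measurable_EFinP.
  - by move=> n y _; rewrite lee_fin.
  - by move=> y _ m n mn; rewrite lee_fin; exact/lefP/nd_nnsfun_approx.
under eq_fun do rewrite nnsfun_integral_density.
rewrite -monotone_convergence//.
- apply: eq_integral => y _; apply/cvg_lim => //.
  under eq_fun do rewrite EFinM.
  by rewrite EFinM; apply: cvgeZr => //; exact: f_cvg.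
- by move=> n; apply/measurable_EFinP/measurable_funM.
- by move=> n y _; rewrite lee_fin mulr_ge0.
- by move=> y _ m n mn; rewrite lee_fin ler_wpM2r//; exact/lefP/nd_nnsfun_approx.
Qed.

End density.

Section wishart_law.
Local Open Scope ereal_scope.
Context {R : realType} {k : nat}.
Implicit Types (eta : IG R k.+1) (y : 'M[R]_k.+1) (s : 'I_k.+1 -> R).

Lemma measurable_diag_coord i :
  measurable_fun setT (fun eta : IG R k.+1 => diag_coord eta i).
Proof.
have := measurableT_comp (@measurable_tuple_nth R k.+1 i)
  (@measurable_fst _ _ (k.+1.-tuple R) (k.-tuple R)).
exact.
Qed.

Lemma measurable_edge_coord i :
  measurable_fun setT (fun eta : IG R k.+1 => edge_coord eta i).
Proof.
have := measurableT_comp (@measurable_tuple_nth R k i)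
  (@measurable_snd _ _ (k.+1.-tuple R) (k.-tuple R)).
exact.
Qed.

Lemma measurable_wishart_density M s y :
  measurable_fun setT (wishart_density M s y : IG R k.+1 -> R).
Proof.
apply: (@measurable_path_density _ k _ _ _ _ _ _ (fun i (eta : IG R k.+1) => diag_coord eta i)
  (fun i eta => edge_coord eta i)) => i.
- exact: measurable_diag_coord.
- exact: measurable_edge_coord.
Qed.

Lemma wishart_density_ge0 M s y eta : (0 <= wishart_density M s y eta)%R.
Proof. exact: path_density_ge0. Qed.

Lemma measurable_pairing y : ZG y ->
  measurable_fun setT (fun eta : IG R k.+1 => pairing eta y).
Proof.
move=> Zy; rewrite (_ : (fun eta => _) = fun eta => lin_pairing k (diag_entries y)
    (offdiag_entries y) (diag_coord eta) (edge_coord eta)); last first.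
  by apply/funext => eta; exact: pairingE.
apply: measurable_funD.
  apply: measurable_sum => i; apply: measurable_funM => //.
  exact: measurable_diag_coord.
apply: measurable_funM => //; apply: measurable_sum => i; apply: measurable_funM => //.
exact: measurable_edge_coord.
Qed.

(** The constant C is allowed to be +oo; that it is finite and positive is read off
    from the total mass of the law in wishart_laplace_transform. *)
Lemma integral_wishart_density M s : (M <= k)%N -> exists2 C : \bar R, 0 <= C &
  forall y, PG y -> \int[@lebesgueI R k.+1]_eta (wishart_density M s y eta)%:E =
  C * (expR (- log_laplace M k (shape_seq s) (diag_entries y) (offdiag_entries y)))%:E.
Proof.
move=> Mk; have [C C0 HC] := path_laplace (shape_seq s) Mk.
exists C => // y py; rewrite -HC; last exact: PG_positive_minors.
rewrite -(integral_path_weight k) ?(vertex_factors_ge0, edge_kernels_ge0); last 4 first.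
- exact: vertex_factors_ge0.
- exact: edge_kernels_ge0.
- exact: measurable_vertex_factors.
- exact: measurable_edge_kernels.
transitivity (\int[lebesgue_tuple k.+1 \x lebesgue_tuple k]_eta
   (wishart_density M s y eta)%:E) => //.
rewrite (@fubini_tonelli1 _ _ _ _ R (lebesgue_tuple k.+1) (lebesgue_tuple k)
  (fun eta => (wishart_density M s y eta)%:E)).
- apply: eq_integral => t _.
  have := integral_path_density_edges k (vertex_exponent M k (shape_seq s))
    (diag_entries y) (edge_exponent M (shape_seq s)) (offdiag_entries y) (nth 0%R t).
  exact.
- by apply/measurable_EFinP; exact: measurable_wishart_density.
- by move=> eta; rewrite lee_fin; exact: wishart_density_ge0.
Qed.

Lemma integral_wishart_fun M s y (A : set (IG R k.+1)) : (M <= k)%N -> ZG y ->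
  measurable A ->
  \int[@lebesgueI R k.+1]_(eta in A `&` QG) (wishart_fun M.+1 s y eta)%:E =
  \int[@lebesgueI R k.+1]_(eta in A) (wishart_density M s y eta)%:E.
Proof.
move=> Mk Zy mA; rewrite [LHS]integral_mkcond [RHS]integral_mkcond.
apply: eq_integral => eta _; rewrite !patchE in_setI.
have [etaA|] //= := boolP (eta \in A).
case: ifPn => [/set_mem Qeta|/negP nQ]; first by rewrite wishart_funE.
rewrite wishart_density_notin// => /QG_in_dual_cone Q; apply: nQ; exact/mem_set.
Qed.

(** Minus the logarithm of the Laplace transform at y, up to a constant. *)
Definition log_norm M s y : R :=
  log_laplace M k (shape_seq s) (diag_entries y) (offdiag_entries y).

(** Since the law is a probability measure, its normalising integral is neither 0
    nor +oo. Tilting the density by exp(- <eta, y' - y>) gives the density at y', and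
    the constant cancels in the quotient of the two normalising integrals. *)
Lemma wishart_laplace_transform M s y d (Omega : measurableType d)
    (P : probability Omega R) (X : {RV P >-> IG R k.+1}) : (M <= k)%N -> PG y ->
  (forall A : set (IG R k.+1), measurable A ->
     distribution P X A = wishart M.+1 s y A) ->
  forall y', PG y' ->
  \int[P]_w (expR (- pairing (X w) (y' - y)))%:E =
  (expR (log_norm M s y - log_norm M s y'))%:E.
Proof.
move=> Mk py hX y' py'; have [Zy _] := py; have [Zy' _] := py'.
have [C C0 HC] := integral_wishart_density s Mk.
pose Z := \int[@lebesgueI R k.+1]_(eta in QG) (wishart_fun M.+1 s y eta)%:E.
have ZE : Z = C * (expR (- log_norm M s y))%:E.
  by rewrite -HC// -(integral_wishart_fun s Mk Zy measurableT) setTI.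
have hX1 : 1 = (fine Z)^-1%:E * Z.
  have := hX setT measurableT; rewrite /wishart setTI -/Z => <-.
  by rewrite /distribution /pushforward preimage_setT probability_setT.
(* fine sends +oo to 0, so total mass one excludes both 0 and +oo *)
have [c c0 Cc] : exists2 c : R, (0 < c)%R & C = c%:E.
  move: hX1; rewrite ZE; case: C C0 {HC ZE} => [c c0| _ |//].
    rewrite -EFinM /= => -[] /esym /eqP; have [->|cn0] := eqVneq c 0%R.
      by rewrite mul0r mulr0 (eq_sym 0%R) oner_eq0.
    by exists c => //; rewrite lt_neqAle eq_sym cn0 -lee_fin.
  by rewrite gt0_mulye ?lte_fin ?expR_gt0//= invr0 mul0e => /eqP; rewrite onee_eq0.
pose z := (c * expR (- log_norm M s y))%R.
have z0 : (0 < z)%R by rewrite mulr_gt0// expR_gt0.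
have ZE' : Z = z%:E by rewrite ZE Cc -EFinM.
pose h eta := (z^-1 * wishart_density M s y eta)%R.
have mh : measurable_fun setT (h : IG R k.+1 -> R).
  by apply: measurable_funM => //; exact: measurable_wishart_density.
have h0 eta : (0 <= h eta)%R.
  by rewrite mulr_ge0 ?invr_ge0 ?wishart_density_ge0// ltW.
have hE A : measurable A -> distribution P X A =
    \int[@lebesgueI R k.+1]_(eta in A) (h eta)%:E.
  move=> mA; rewrite hX// /wishart -/Z ZE' /= integral_wishart_fun//.
  rewrite -ge0_integralZl//.
  - by apply/measurable_EFinP/measurable_funTS; exact: measurable_wishart_density.
  - by move=> eta _; rewrite lee_fin wishart_density_ge0.
  - by rewrite lee_fin invr_ge0 ltW.
pose g eta := expR (- pairing eta (y' - y)).
have mg : measurable_fun setT (g : IG R k.+1 -> R).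
  apply: measurableT_comp => //; apply: measurableT_comp => //.
  apply: measurable_pairing; rewrite -[y']scale1r -scaleN1r; exact: ZG_lincomb.
have g0 eta : (0 <= g eta)%R by exact: expR_ge0.
transitivity (\int[distribution P X]_eta (g eta)%:E).
  by rewrite ge0_integral_distribution//; exact/measurable_EFinP.
rewrite (ge0_integral_density mh h0 hE mg g0).
transitivity (\int[@lebesgueI R k.+1]_eta (z^-1%:E * (wishart_density M s y' eta)%:E)).
  apply: eq_integral => eta _; rewrite -EFinM (wishart_density_tilt _ _ _ Zy Zy').
  by rewrite /h mulrCA.
rewrite ge0_integralZl//; last 3 first.
- by apply/measurable_EFinP; exact: measurable_wishart_density.
- by move=> eta _; rewrite lee_fin wishart_density_ge0.
- by rewrite lee_fin invr_ge0 ltW.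
rewrite HC// Cc -!EFinM -/(log_norm M s y') /z expRB !expRN.
by congr EFin; field; rewrite !gt_eqF ?expR_gt0.
Qed.

End wishart_law.

(** * Sums over permutations by cycles *)

Section cycles.
Context {N : nat}.
Implicit Types (p : 'S_N) (c : {set 'I_N}).

Lemma porbit_step p x : porbit p (p x) = porbit p x.
Proof. by have := porbit_perm p 1 x; rewrite expg1. Qed.

Lemma porbit_iter p i x : porbit p (iter i p x) = porbit p x.
Proof. by elim: i => //= i IH; rewrite porbit_step. Qed.

Lemma porbits_porbit p x : porbit p x \in porbits p.
Proof. exact: imset_f. Qed.

Lemma porbitsP p c : reflect (exists x, c = porbit p x) (c \in porbits p).
Proof.
by apply: (iffP imsetP) => [[x _ ->]|[x ->]]; exists x.
Qed.

(** Starting a cycle one step later rotates its list of elements. *)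
Lemma traject_porbit_rot p x : let k := #|porbit p x| in
  traject p (p x) k = rot 1 (traject p x k).
Proof.
move=> k; have := card_porbit_neq0 p x; rewrite -/k; case E : k => [//|k'] _.
rewrite [in RHS]trajectS rot1_cons trajectSr; congr (rcons _ _).
by rewrite -iterSr -E iter_porbit.
Qed.

Lemma cycle_seqE p c : c \in porbits p ->
  exists2 x, c = porbit p x & cycle_seq p c = traject p x #|porbit p x|.
Proof.
move=> /porbitsP[y cy]; rewrite /cycle_seq; case: pickP => [x xc|/(_ y)]; last first.
  by rewrite cy porbit_id.
have cx : c = porbit p x by apply/eqP; rewrite cy eq_sym eq_porbit_mem -cy.
by exists x => //; rewrite -cx.
Qed.

End cycles.

Section insertion.
Context {V : comPzRingType} {T : Type} (f : seq T -> V).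
Hypothesis f_rot1 : forall l, f (rot 1 l) = f l.

Lemma f_rot i l : f (rot i l) = f l.
Proof.
have [il|li] := ltnP i (size l); last by rewrite rot_oversize.
elim: i il => [|i IH] il; first by rewrite rot0.
by rewrite -[i.+1]add1n rotD ?add1n 1?ltnW// f_rot1 IH// ltnW.
Qed.

Definition insert_at (i : nat) (x : T) (l : seq T) := take i l ++ x :: drop i l.

Lemma f_insert_at i x l : (i <= size l)%N -> f (insert_at i x l) = f (x :: rot i l).
Proof.
move=> il; rewrite -(f_rot i (insert_at i x l)) /insert_at.
by rewrite -{1}(size_takel il) rot_size_cat /rot.
Qed.

Definition cycle_value N (z : 'I_N -> T) (p : 'S_N) (c : {set 'I_N}) : V :=
  f (map z (cycle_seq p c)).

(** The sum over permutations of the products of the values of f on the cycles,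
    for a function f of lists that does not depend on the starting point. *)
Definition cycle_sum N (z : 'I_N -> T) : V :=
  (\sum_(p : 'S_N) \prod_(c in porbits p) cycle_value z p c)%R.

Section one_permutation.
Context {N : nat}.
Implicit Types (z : 'I_N -> T) (p : 'S_N) (c : {set 'I_N}).

Lemma f_traject z p x y : y \in porbit p x ->
  f (map z (traject p y #|porbit p x|)) = f (map z (traject p x #|porbit p x|)).
Proof.
move=> /porbitP[i ->]; rewrite permX.
elim: i => //= i <-.
by rewrite -(porbit_iter p i x) traject_porbit_rot map_rot f_rot1.
Qed.

Lemma cycle_value_porbit z p x :
  cycle_value z p (porbit p x) = f (map z (traject p x #|porbit p x|)).
Proof.
rewrite /cycle_value; have [y xy ->] := cycle_seqE (porbits_porbit p x).
by rewrite -xy f_traject// xy porbit_id.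
Qed.

(** Up to rotation, inserting x0 at position i of a cycle is putting x0 in front of
    the cycle started at its i-th element. *)
Lemma sum_insert_at z p c (x0 : T) : c \in porbits p ->
  (\sum_(0 <= i < size (cycle_seq p c)) f (insert_at i x0 (map z (cycle_seq p c))) =
   \sum_(u in c) f (x0 :: map z (traject p u #|porbit p u|)))%R.
Proof.
move=> /cycle_seqE[x -> ->]; rewrite size_traject; set k := #|porbit p x|.
transitivity (\sum_(u <- traject p x k) f (x0 :: map z (traject p u #|porbit p u|)))%R.
  rewrite (big_nth x) size_traject; apply: eq_big_nat => i /andP[_ ik].
  rewrite nth_traject// f_insert_at ?size_map ?size_traject 1?ltnW//.
  congr (f (_ :: _)); rewrite -map_rot; congr map.
  rewrite porbit_iter -/k; elim: i ik => [|i IH] ik; first by rewrite rot0.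
  rewrite -[in LHS]add1n rotD ?size_traject ?add1n 1?ltnW// IH 1?ltnW//= /k -(porbit_iter p i x).
  by rewrite traject_porbit_rot.
rewrite big_uniq ?uniq_traject_porbit//=.
by apply: eq_bigl => u; rewrite -porbit_traject.
Qed.

End one_permutation.

Section extension.
Context {N : nat}.
Variables (p : 'S_N) (j : 'I_N.+1).
Local Notation up := (lift (@ord0 N)).

(** Every permutation of N + 1 points arises once in this way: delete the point 0
    from its cycle to obtain p, and let j be the image of 0. For j = 0 the point 0 is
    fixed; otherwise 0 is inserted in the cycle of p just before j. *)
Definition extend_perm : 'S_N.+1 := (lift_perm ord0 ord0 p * tperm ord0 j)%g.

Lemma extend_perm0 : extend_perm ord0 = j.
Proof. by rewrite permM lift_perm_id tpermL. Qed.

Lemma extend_perm_up x : up (p x) != j -> extend_perm (up x) = up (p x).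
Proof. by move=> pxj; rewrite permM lift_perm_lift tpermD// eq_sym. Qed.

Lemma extend_perm_upj x : up (p x) = j -> extend_perm (up x) = ord0.
Proof. by move=> pxj; rewrite permM lift_perm_lift pxj tpermR. Qed.

Variable z : 'I_N.+1 -> T.
Variable D : {set 'I_N}.
Hypothesis D_stable : forall x, x \in D -> p x \in D.
Hypothesis D_avoids : forall x, x \in D -> up x != j.
Hypothesis D_orbit0 : forall x, x \notin D -> up x \in porbit extend_perm ord0.

Lemma iter_extend_perm_up i x : x \in D ->
  iter i extend_perm (up x) = up (iter i p x) /\ iter i p x \in D.
Proof.
move=> xD; elim: i => //= i [-> iD]; rewrite extend_perm_up ?D_avoids ?D_stable//.
Qed.

Lemma porbit_extend_up x : x \in D -> porbit extend_perm (up x) = up @: porbit p x.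
Proof.
move=> xD; apply/setP => y; apply/porbitP/imsetP => [[i ->]|[w /porbitP[i ->] ->]].
  exists (iter i p x); last by rewrite permX; have [] := iter_extend_perm_up i xD.
  by apply/porbitP; exists i; rewrite permX.
by exists i; rewrite !permX; have [] := iter_extend_perm_up i xD.
Qed.

Lemma cycle_value_extend_up x : x \in D ->
  cycle_value z extend_perm (porbit extend_perm (up x)) =
  cycle_value (z \o up) p (porbit p x).
Proof.
move=> xD; rewrite !cycle_value_porbit porbit_extend_up// card_imset; last exact: lift_inj.
congr f; rewrite map_comp; congr map.
apply: (@eq_from_nth _ (up x)) => [|i]; first by rewrite size_map !size_traject.
rewrite size_traject => ik; rewrite (nth_map x) ?size_traject// nth_traject// nth_traject//.
by have [] := iter_extend_perm_up i xD.
Qed.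

(** D is the set of points whose cycles in p are not touched by the insertion of 0;
    these cycles are copied, and the only other cycle is that of 0. *)
Lemma prod_cycle_value_extend :
  (\prod_(c in porbits extend_perm) cycle_value z extend_perm c =
   cycle_value z extend_perm (porbit extend_perm ord0) *
   \prod_(c in porbits p | c \subset D) cycle_value (z \o up) p c)%R.
Proof.
rewrite (bigD1 (porbit extend_perm ord0)) ?porbits_porbit//=; congr (_ * _)%R.
have D_porbit x : (porbit p x \subset D) = (x \in D).
  apply/idP/idP => [/fintype.subsetP -> //|xD]; first exact: porbit_id.
  apply/fintype.subsetP => y /porbitP[i ->]; rewrite permX.
  by have [] := iter_extend_perm_up i xD.
pose A := [set c in porbits p | c \subset D]%SET.
have imA : [set c in porbits extend_perm | c != porbit extend_perm ord0]%SET =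
    (fun c : {set 'I_N} => up @: c) @: A.
  apply/setP => c; rewrite inE; apply/andP/imsetP.
    move=> [/porbitsP[x ->] x0]; case: (unliftP ord0 x) x0 => [y|] -> x0; last first.
      by rewrite eqxx in x0.
    have yD : y \in D.
      by apply: contraNT x0 => /D_orbit0; rewrite eq_porbit_mem.
    by exists (porbit p y); rewrite ?inE ?porbits_porbit ?D_porbit// porbit_extend_up.
  move=> [c']; rewrite inE => /andP[/porbitsP[x ->]]; rewrite D_porbit => xD ->.
  rewrite -porbit_extend_up// porbits_porbit; split=> //.
  rewrite eq_sym eq_porbit_mem porbit_extend_up//.
  by apply/negP => /imsetP[w _] /eqP; rewrite (negbTE (neq_lift _ _)).
rewrite -big_set/= imA big_imset/=; last first.
  by move=> c1 c2 _ _; apply: imset_inj; exact: lift_inj.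
rewrite big_set; apply: eq_bigr => c /andP[/porbitsP[x cx] +].
by rewrite cx D_porbit => xD; rewrite -porbit_extend_up// cycle_value_extend_up.
Qed.

End extension.

Section recurrence.
Context {N : nat}.
Variable z : 'I_N.+1 -> T.
Implicit Types (p : 'S_N) (u : 'I_N).
Local Notation up := (lift (@ord0 N)).

Lemma prod_extend_fixed p :
  (\prod_(c in porbits (extend_perm p ord0)) cycle_value z (extend_perm p ord0) c =
   f [:: z ord0] * \prod_(c in porbits p) cycle_value (z \o up) p c)%R.
Proof.
rewrite (@prod_cycle_value_extend N p ord0 z [set: 'I_N]%SET) => [||x _|x]; last 3 first.
- by [].
- by rewrite eq_sym neq_lift.
- by rewrite inE.
rewrite cycle_value_porbit; congr (_ * _)%R; last first.
  by apply: eq_bigl => c; rewrite finset.subsetT andbT.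
have -> : porbit (extend_perm p ord0) ord0 = [set ord0]%SET.
  apply/setP => y; rewrite inE; apply/porbitP/eqP => [[i ->]|->].
    by rewrite permX; elim: i => //= i ->; rewrite extend_perm0.
  by exists 0%N; rewrite perm1.
by rewrite cards1.
Qed.

Lemma prod_extend_inserted p u :
  (\prod_(c in porbits (extend_perm p (up u))) cycle_value z (extend_perm p (up u)) c =
   f (z ord0 :: map (z \o up) (traject p u #|porbit p u|)) *
   \prod_(c in porbits p | c != porbit p u) cycle_value (z \o up) p c)%R.
Proof.
set s := extend_perm p (up u); set k := #|porbit p u|.
have k0 : (0 < k)%N by rewrite lt0n card_porbit_neq0.
have iter_s i : (i < k)%N -> iter i.+1 s ord0 = up (iter i p u).
  elim: i => [_|i IH ik]; first by rewrite /= /s extend_perm0.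
  rewrite iterS IH 1?ltnW// /s extend_perm_up// (inj_eq lift_inj).
  have := @nth_uniq _ u (traject p u k) 0 i.+1; rewrite !size_traject !nth_traject//.
  by move=> /(_ k0 ik (uniq_traject_porbit p u)); rewrite eq_sym => ->.
have orbit_s : porbit s ord0 = (ord0 |: up @: porbit p u)%SET.
  apply/setP => y; apply/porbitP/setU1P => [[i ->]|].
    rewrite permX; elim: i => [|i]; first by left.
    rewrite iterS => -[->|/imsetP[w wu ->]].
      by right; rewrite /s extend_perm0 imset_f ?porbit_id.
    have [pwu|pwu] := eqVneq (up (p w)) (up u); first by left; exact: extend_perm_upj.
    right; rewrite /s extend_perm_up// imset_f//.
    by rewrite -eq_porbit_mem porbit_step eq_porbit_mem.
  move=> [->|/imsetP[w + ->]]; first by exists 0%N; rewrite perm1.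
  rewrite porbit_traject => /trajectP[i ik ->].
  by exists i.+1; rewrite permX iter_s.
rewrite (@prod_cycle_value_extend N p (up u) z (~: porbit p u)%SET) => [|x|x|x]; last 3 first.
- by rewrite !inE -!(porbit_sym p u) -!eq_porbit_mem porbit_step.
- by rewrite inE (inj_eq lift_inj); apply: contraNneq => ->; exact: porbit_id.
- by rewrite inE negbK -/s orbit_s !inE => xu; rewrite imset_f ?orbT.
rewrite cycle_value_porbit -/s; congr (_ * _)%R; last first.
  apply: eq_bigl => c; case: (boolP (c \in porbits p)) => //= /porbitsP[x ->].
  rewrite eq_porbit_mem; apply/fintype.subsetP/idP => [/(_ x (porbit_id p x))|xu y yx].
    by rewrite inE.
  by rewrite inE -eq_porbit_mem (eqP (_ : porbit p y == porbit p x)) eq_porbit_mem.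
rewrite orbit_s cardsU1 card_imset; last exact: lift_inj.
have -> : ord0 \notin up @: porbit p u.
  by apply/negP => /imsetP[w _] /eqP; rewrite (negbTE (neq_lift _ _)).
rewrite -/k add1n trajectS /= map_comp; congr (f (_ :: map _ _)).
apply: (@eq_from_nth _ (s ord0)) => [|i]; first by rewrite size_map !size_traject.
rewrite size_traject => ik; rewrite nth_traject// -iterSr iter_s//.
by rewrite (nth_map u) ?size_traject// nth_traject.
Qed.

(** Classifying the permutations of N + 1 points by extend_perm. The terms have
    the shape of a Leibniz rule: either a new factor appears, or z_0 is inserted in
    one of the cycles. This is what matches derivation in the direction z_0. *)
Lemma cycle_sum_rec : (cycle_sum z = \sum_(p : 'S_N)
  (f [:: z ord0] * \prod_(c in porbits p) cycle_value (z \o up) p c +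
   \sum_(c in porbits p)
     (\sum_(0 <= i < size (cycle_seq p c))
        f (insert_at i (z ord0) (map (z \o up) (cycle_seq p c)))) *
     \prod_(c' in porbits p | c' != c) cycle_value (z \o up) p c'))%R.
Proof.
pose e (pj : 'S_N * 'I_N.+1) := extend_perm pj.1 pj.2.
have e_inj : injective e.
  move=> [p j] [p' j'] pp; have jj : j = j'.
    by have := congr1 (fun s : 'S_N.+1 => s ord0) pp; rewrite /e/= !extend_perm0.
  rewrite jj in pp *; congr pair; apply/permP => x.
  move: pp; rewrite /e /extend_perm /= => /mulIg pp.
  have := congr1 (fun s : 'S_N.+1 => s (up x)) pp.
  by rewrite /= !lift_perm_lift => /lift_inj.
have e_bij : bijective e.
  by apply: inj_card_bij e_inj _; rewrite card_prod !card_Sn card_ord factS mulnC.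
rewrite /cycle_sum (reindex e); last exact: onW_bij.
rewrite -(pair_bigA _ (fun p j => \prod_(c in porbits (extend_perm p j))
  cycle_value z (extend_perm p j) c)%R)/=.
apply: eq_bigr => p _; rewrite big_ord_recl prod_extend_fixed; congr (_ + _)%R.
rewrite (eq_bigr _ (fun u _ => prod_extend_inserted p u)).
rewrite (partition_big (porbit p) (fun c => c \in porbits p))/=; last first.
  by move=> u _; exact: porbits_porbit.
apply: eq_bigr => c cp; rewrite (sum_insert_at _ _ cp) big_distrl/=.
have cE u : (porbit p u == c) = (u \in c).
  by have /porbitsP[x ->] := cp; rewrite eq_porbit_mem.
rewrite (eq_bigl _ _ cE); apply: eq_bigr => u uc; congr (_ * _)%R.
by move: uc; rewrite -cE => /eqP ->.
Qed.

End recurrence.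

End insertion.

(** * Derivatives along lines *)

Section derivatives.
Context {R : realType}.
Implicit Types (f g : R -> R).

(** Only derivatives at 0 along lines y + t z occur. *)
Definition has_deriv0 f (df : R) := is_derive (0 : R) (1 : R) f df.

Lemma has_deriv0_cst c : has_deriv0 (fun=> c) 0.
Proof. exact: is_derive_cst. Qed.

Lemma has_deriv0D f g a b : has_deriv0 f a -> has_deriv0 g b ->
  has_deriv0 (fun t => f t + g t) (a + b).
Proof. exact: is_deriveD. Qed.

Lemma has_deriv0N f a : has_deriv0 f a -> has_deriv0 (fun t => - f t) (- a).
Proof. exact: is_deriveN. Qed.

Lemma has_deriv0M f g a b : has_deriv0 f a -> has_deriv0 g b ->
  has_deriv0 (fun t => f t * g t) (a * g 0 + f 0 * b).
Proof.
move=> fa gb; have := is_deriveM fa gb.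
by rewrite /has_deriv0 addrC -[_ *: a]mulrC.
Qed.

Lemma has_deriv0Ml c f a : has_deriv0 f a -> has_deriv0 (fun t => c * f t) (c * a).
Proof.
by move=> fa; have := has_deriv0M (has_deriv0_cst c) fa; rewrite mul0r add0r.
Qed.

Lemma has_deriv0_affine a b : has_deriv0 (fun t => a + t * b) b.
Proof.
have := has_deriv0D (has_deriv0_cst a) (has_deriv0M (is_derive_id (0 : R) (1 : R)) (has_deriv0_cst b)).
by rewrite add0r mulr0 addr0 mul1r.
Qed.

Lemma has_deriv0_sum (I : Type) (r : seq I) (P : pred I) (F : I -> R -> R) (dF : I -> R) :
  (forall i, P i -> has_deriv0 (F i) (dF i)) ->
  has_deriv0 (fun t => \sum_(i <- r | P i) F i t) (\sum_(i <- r | P i) dF i).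
Proof.
move=> HF; elim: r => [|i r IH].
  rewrite big_nil; under [X in has_deriv0 X]eq_fun do rewrite big_nil.
  exact: has_deriv0_cst.
rewrite big_cons; under [X in has_deriv0 X]eq_fun do rewrite big_cons.
by case: ifPn => // Pi; apply: has_deriv0D => //; exact: HF.
Qed.

Lemma has_deriv0_prod_seq (I : eqType) (r : seq I) (F : I -> R -> R) (dF : I -> R) :
  uniq r -> (forall i, i \in r -> has_deriv0 (F i) (dF i)) ->
  has_deriv0 (fun t => \prod_(i <- r) F i t)
    (\sum_(i <- r) dF i * \prod_(j <- r | j != i) F j 0).
Proof.
elim: r => [_ _|x r IH /= /andP[xr ur] HF].
  rewrite big_nil; under [X in has_deriv0 X]eq_fun do rewrite big_nil.
  exact: has_deriv0_cst.
rewrite big_cons; under [X in has_deriv0 X]eq_fun do rewrite big_cons.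
have -> : \prod_(j <- x :: r | j != x) F j 0 = \prod_(j <- r) F j 0.
  rewrite big_cons eqxx /= [RHS]big_seq [LHS]big_seq_cond; apply: eq_bigl => j.
  by case: (boolP (j \in r)) => //= jr; apply: contraNneq xr => <-.
have -> : \sum_(i <- r) dF i * \prod_(j <- x :: r | j != i) F j 0 =
    F x 0 * \sum_(i <- r) dF i * \prod_(j <- r | j != i) F j 0.
  rewrite mulr_sumr; apply: eq_big_seq => i ir.
  have xi : x != i by apply: contraNneq xr => ->.
  by rewrite big_cons xi mulrCA.
apply: has_deriv0M; first by apply: HF; rewrite mem_head.
by apply: IH => // i ir; apply: HF; rewrite inE ir orbT.
Qed.

Lemma has_deriv0_prod (I : finType) (P : pred I) (F : I -> R -> R) (dF : I -> R) :
  (forall i, P i -> has_deriv0 (F i) (dF i)) ->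
  has_deriv0 (fun t => \prod_(i | P i) F i t)
    (\sum_(i | P i) dF i * \prod_(j | P j && (j != i)) F j 0).
Proof.
move=> HF.
have -> : (fun t => \prod_(i | P i) F i t) = fun t => \prod_(i <- enum P) F i t.
  by apply/funext => t; rewrite big_enum.
have -> : \sum_(i | P i) dF i * \prod_(j | P j && (j != i)) F j 0 =
    \sum_(i <- enum P) dF i * \prod_(j <- enum P | j != i) F j 0.
  rewrite [RHS]big_enum/=; apply: eq_bigr => i _.
  by rewrite big_enum_cond/=.
apply: has_deriv0_prod_seq; first exact: enum_uniq.
by move=> i; rewrite mem_enum; exact: HF.
Qed.

Lemma has_deriv0_expR f a : has_deriv0 f a ->
  has_deriv0 (fun t => expR (f t)) (a * expR (f 0)).
Proof.
move=> fa; rewrite mulrC; exact: (is_derive1_comp (is_derive_expR _) fa).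
Qed.

Lemma has_deriv0_ln f a : 0 < f 0 -> has_deriv0 f a ->
  has_deriv0 (fun t => ln (f t)) (a / f 0).
Proof.
move=> f0 fa; rewrite mulrC; exact: (is_derive1_comp (is_derive1_ln f0) fa).
Qed.

Lemma has_deriv0_inv f a : f 0 != 0 -> has_deriv0 f a ->
  has_deriv0 (fun t => (f t)^-1) (- (f 0) ^- 2 * a).
Proof.
move=> f0 fa; apply: DeriveDef.
  exact: derivableV f0 (@ex_derive _ _ _ _ _ _ _ fa).
by rewrite deriveV// ?(@derive_val _ _ _ _ _ _ _ fa)//; exact: (@ex_derive _ _ _ _ _ _ _ fa).
Qed.

Lemma has_deriv0_near f g a : (\forall t \near (0 : R), f t = g t) ->
  has_deriv0 f a -> has_deriv0 g a.
Proof.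
move=> fg fa; apply: DeriveDef.
  exact: near_eq_derivable fg (@ex_derive _ _ _ _ _ _ _ fa).
by rewrite -(near_eq_derive _ fg) (@derive_val _ _ _ _ _ _ _ fa).
Qed.

Lemma has_deriv0_unique f g a b : (\forall t \near (0 : R), f t = g t) ->
  has_deriv0 f a -> has_deriv0 g b -> a = b.
Proof.
move=> fg /(has_deriv0_near fg) ga gb.
by rewrite -(@derive_val _ _ _ _ _ _ _ ga) (@derive_val _ _ _ _ _ _ _ gb).
Qed.

Lemma has_deriv0_continuous f a : has_deriv0 f a -> {for 0, continuous f}.
Proof.
move=> fa; apply: differentiable_continuous; apply/derivable1_diffP.
exact: (@ex_derive _ _ _ _ _ _ _ fa).
Qed.

Lemma has_deriv0_neq0 f a : has_deriv0 f a -> f 0 != 0 -> \forall t \near (0 : R), f t != 0.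
Proof.
move=> /has_deriv0_continuous cf f0.
exact: cvgr_neq0 cf f0.
Qed.

End derivatives.

Section matrix_derivatives.
Context {R : realType}.

Definition has_deriv0_mx m n (X : R -> 'M[R]_(m, n)) (dX : 'M[R]_(m, n)) :=
  forall i j, has_deriv0 (fun t => X t i j) (dX i j).

Lemma has_deriv0_mx_affine m n (A B : 'M[R]_(m, n)) :
  has_deriv0_mx (fun t => A + t *: B) B.
Proof.
move=> i j; have := has_deriv0_affine (A i j) (B i j).
by congr has_deriv0; apply/funext => t; rewrite !mxE.
Qed.

Lemma has_deriv0_mx_cst m n (A : 'M[R]_(m, n)) : has_deriv0_mx (fun=> A) 0.
Proof. by move=> i j; rewrite mxE; exact: has_deriv0_cst. Qed.

Lemma has_deriv0_mulmx m n q (X : R -> 'M[R]_(m, n)) (Y : R -> 'M[R]_(n, q)) dX dY :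
  has_deriv0_mx X dX -> has_deriv0_mx Y dY ->
  has_deriv0_mx (fun t => X t *m Y t) (dX *m Y 0 + X 0 *m dY).
Proof.
move=> HX HY i j.
have := @has_deriv0_sum _ _ (index_enum 'I_n) xpredT (fun k t => X t i k * Y t k j)
  (fun k => dX i k * Y 0 k j + X 0 i k * dY k j)
  (fun k _ => has_deriv0M (HX i k) (HY k j)).
rewrite big_split/= !mxE; congr has_deriv0.
by apply/funext => t; rewrite mxE.
Qed.

Lemma has_deriv0_det_ex n (X : R -> 'M[R]_n) dX : has_deriv0_mx X dX ->
  exists d, has_deriv0 (fun t => \det (X t)) d.
Proof.
move=> HX; rewrite /determinant; eexists; apply: has_deriv0_sum => s _.
by apply: has_deriv0Ml; apply: has_deriv0_prod => i _; exact: HX.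
Qed.

(** In Leibniz' formula only the identity contributes, since any other permutation
    moves at least two points. *)
Lemma has_deriv0_det1 n (C : 'M[R]_n) :
  has_deriv0 (fun t => \det (1%:M + t *: C)) (\tr C).
Proof.
rewrite /determinant.
have := @has_deriv0_sum _ _ (index_enum 'S_n) xpredT
  (fun s t => (-1) ^+ s * \prod_i (1%:M + t *: C) i (s i)) _
  (fun s _ => has_deriv0Ml ((-1) ^+ s)
    (has_deriv0_prod (P := xpredT) (fun i _ => has_deriv0_mx_affine 1%:M C i (s i)))).
rewrite (bigD1 1%g)//= [X in _ + X]big1 ?addr0 => [|s s1].
  rewrite odd_perm1 expr0 mul1r; congr (has_deriv0 _ _); apply: eq_bigr => i _.
  rewrite perm1 big1 ?mulr1// => j _; rewrite perm1 scale0r addr0 !mxE eqxx.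
  by [].
rewrite big1 ?mulr0// => i _.
have [j ji sj] : exists2 j, j != i & s j != j.
  apply: contrapT => nosj; move/eqP: s1; apply; apply/permP => j; rewrite perm1.
  have fixed l : l != i -> s l = l.
    by move=> li; apply: contrapT => /eqP sl; apply: nosj; exists l.
  have [->|/fixed//] := eqVneq j i.
  by have [//|/fixed] := eqVneq (s i) i; exact: perm_inj.
rewrite (bigD1 j)//= scale0r addr0 mxE eq_sym (negbTE sj) mul0r mulr0.
by [].
Qed.

Lemma has_deriv0_det n (A B : 'M[R]_n) : A \in unitmx ->
  has_deriv0 (fun t => \det (A + t *: B)) (\det A * \tr (invmx A *m B)).
Proof.
move=> uA; have := has_deriv0Ml (\det A) (has_deriv0_det1 (invmx A *m B)).
congr has_deriv0; apply/funext => t.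
by rewrite -det_mulmx mulmxDr mulmx1 -scalemxAr mulmxA mulmxV// mul1mx.
Qed.

Lemma near_unitmx n (A B : 'M[R]_n) : A \in unitmx ->
  \forall t \near (0 : R), A + t *: B \in unitmx.
Proof.
move=> uA; have dA : \det (A + 0 *: B) != 0.
  by rewrite scale0r addr0 -unitfE -unitmxE.
near=> t; rewrite unitmxE unitfE; near: t.
exact: (has_deriv0_neq0 (has_deriv0_det B uA) dA).
Unshelve. all: by end_near. Qed.

(** Cramer's rule shows that the entries are differentiable; the value of the
    derivative then follows by differentiating A A^-1 = 1. *)
Lemma has_deriv0_invmx n (A B : 'M[R]_n) : A \in unitmx ->
  has_deriv0_mx (fun t => invmx (A + t *: B)) (- (invmx A *m B *m invmx A)).
Proof.
move=> uA.
have A0 : A + 0 *: B = A by rewrite scale0r addr0.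
have dA : \det (A + 0 *: B) != 0 by rewrite A0 -unitfE -unitmxE.
have [dI HI] : exists dI, has_deriv0_mx (fun t => invmx (A + t *: B)) dI.
  have H i j : exists d, has_deriv0 (fun t => invmx (A + t *: B) i j) d.
    have [dadj Hadj] : exists d, has_deriv0 (fun t => \adj (A + t *: B) i j) d.
      have [|d Hd] := @has_deriv0_det_ex _ (fun t => row' j (col' i (A + t *: B)))
        (row' j (col' i B)).
        move=> i' j'; have := has_deriv0_mx_affine A B (lift j i') (lift i j').
        by rewrite !mxE; congr has_deriv0; apply/funext => t; rewrite !mxE.
      exists ((-1) ^+ (j + i) * d); have := has_deriv0Ml ((-1) ^+ (j + i)) Hd.
      by congr has_deriv0; apply/funext => t; rewrite mxE.
    have Hinv := has_deriv0_inv dA (has_deriv0_det B uA).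
    eexists; apply: has_deriv0_near (has_deriv0M Hinv Hadj).
    near=> t; have ut : A + t *: B \in unitmx by near: t; exact: near_unitmx.
    by rewrite /invmx ut [RHS]mxE.
  pose dI : 'M[R]_n := \matrix_(i, j) sval (cid (H i j)).
  by exists dI => i j; rewrite mxE; case: cid.
suff -> : - (invmx A *m B *m invmx A) = dI by [].
have := has_deriv0_mulmx (has_deriv0_mx_affine A B) HI.
rewrite A0 => H.
have E : B *m invmx A + A *m dI = 0.
  apply/matrixP => i j; apply: (has_deriv0_unique _ (H i j)); last first.
    exact: (@has_deriv0_mx_cst _ _ 1%:M i j).
  near=> t; have ut : A + t *: B \in unitmx by near: t; exact: near_unitmx.
  by rewrite mulmxV.
move/eqP: E; rewrite addrC addr_eq0 => /eqP /(congr1 (mulmx (invmx A))).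
by rewrite mulmxA mulVmx// mul1mx mulmxN mulmxA => ->.
Unshelve. all: by end_near. Qed.

End matrix_derivatives.

(** * Derivatives of the Laplace transform and of the traces *)

Section trace_word.
Context {R : realType} {n m : nat}.
Variable rho : 'M[R]_n -> 'M[R]_m.
Hypothesis rhoE : forall y t z, rho (y + t *: z) = rho y + t *: rho z.

Definition word_mx y (l : seq 'M[R]_n) : 'M[R]_m :=
  \prod_(z <- l) (invmx (rho y) *m rho z).

(** The trace of a product of matrices rho(y)^-1 rho(z), where rho is the
    restriction to a set of vertices, or the identity. *)
Definition trace_word y (l : seq 'M[R]_n) : R := \tr (word_mx y l).

Lemma word_mx_cons y z l : word_mx y (z :: l) = (invmx (rho y) *m rho z) *m word_mx y l.
Proof. by rewrite /word_mx big_cons. Qed.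

Lemma word_mx_cat y l1 l2 : word_mx y (l1 ++ l2) = word_mx y l1 *m word_mx y l2.
Proof. by rewrite /word_mx big_cat. Qed.

Lemma trace_word_rot1 y l : trace_word y (rot 1 l) = trace_word y l.
Proof.
case: l => // z l; rewrite /trace_word rot1_cons -cats1 word_mx_cat mxtrace_mulC.
by rewrite !word_mx_cons [word_mx y [::]]big_nil mulmx1.
Qed.

(** Since the derivative of rho(y)^-1 in the direction z is
    - rho(y)^-1 rho(z) rho(y)^-1, differentiating the j-th factor inserts z before it. *)
Lemma has_deriv0_word_mx y z l : rho y \in unitmx ->
  has_deriv0_mx (fun t => word_mx (y + t *: z) l)
    (- \sum_(0 <= i < size l) word_mx y (insert_at i z l)).
Proof.
move=> uy; elim: l => [|w l IH].
  rewrite big_geq// oppr0; have := has_deriv0_mx_cst (word_mx y [::]).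
  by congr has_deriv0_mx; apply/funext => t; rewrite /word_mx !big_nil.
have y0 : y + 0 *: z = y by rewrite scale0r addr0.
have := has_deriv0_mulmx (has_deriv0_mulmx (has_deriv0_invmx (rho z) uy)
  (has_deriv0_mx_cst (rho w))) IH.
have -> : (fun t => invmx (rho y + t *: rho z) *m rho w *m word_mx (y + t *: z) l) =
   fun t => word_mx (y + t *: z) (w :: l).
  by apply/funext => t; rewrite word_mx_cons rhoE.
congr has_deriv0_mx; rewrite -rhoE !y0 mulmx0 addr0 big_nat_recl//= /insert_at /=.
rewrite opprD; congr (_ + _).
  by rewrite !word_mx_cons !mulNmx !mulmxA.
rewrite mulmxN mulmx_sumr; congr (- _); apply: eq_bigr => i _.
by rewrite word_mx_cons.
Qed.

Lemma has_deriv0_trace_word y z l : rho y \in unitmx ->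
  has_deriv0 (fun t => trace_word (y + t *: z) l)
    (- \sum_(0 <= i < size l) trace_word y (insert_at i z l)).
Proof.
move=> uy; rewrite -sumrN.
have := @has_deriv0_sum _ _ (index_enum 'I_m) xpredT _ _
  (fun i _ => @has_deriv0_word_mx y z l uy i i).
congr has_deriv0.
rewrite -[LHS]/(\tr (- \sum_(0 <= i < size l) word_mx y (insert_at i z l))).
by rewrite raddfN (raddf_sum (@mxtrace R m)) -sumrN.
Qed.

Lemma has_deriv0_ln_det y z : 0 < \det (rho y) ->
  has_deriv0 (fun t => ln (\det (rho (y + t *: z)))) (trace_word y [:: z]).
Proof.
move=> dy; have uy : rho y \in unitmx by rewrite unitmxE unitfE gt_eqF.
have := has_deriv0_det (rho z) uy.
have -> : (fun t => \det (rho y + t *: rho z)) = fun t => \det (rho (y + t *: z)).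
  by apply/funext => t; rewrite rhoE.
move=> H; have := has_deriv0_ln _ H; rewrite scale0r addr0 => /(_ dy).
congr has_deriv0; rewrite mulrC mulKf ?gt_eqF//.
by rewrite /trace_word word_mx_cons /word_mx big_nil mulmx1.
Qed.

End trace_word.

Section wishart_functional.
Context {R : realType} {k : nat}.
Implicit Types (y z : 'M[R]_k.+1) (l : seq 'M[R]_k.+1).
Variables (M : nat) (s : 'I_k.+1 -> R).
Hypothesis Mk : (M <= k)%N.

(** The expression in braces in the formula for the moments, for one cycle. *)
Definition wishart_word y l : R :=
  \sum_(1 <= i < M.+1) (vcoord s i - vcoord s i.+1) * trace_word (psubmx (vint 1 i)) y l
  + vcoord s M.+1 * trace_word id y l
  + \sum_(M.+2 <= i < k.+2) (vcoord s i - vcoord s i.-1) *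
      trace_word (psubmx (vint i k.+1)) y l.

Lemma wishart_word_rot1 y l : wishart_word y (rot 1 l) = wishart_word y l.
Proof.
rewrite /wishart_word; congr (_ + _ + _); rewrite ?trace_word_rot1//;
  by apply: eq_bigr => i _; rewrite trace_word_rot1.
Qed.

Lemma psubmx_affine (I : {set 'I_k.+1}) y t z :
  psubmx I (y + t *: z) = psubmx I y + t *: psubmx I z.
Proof. by apply/matrixP => i j; rewrite !mxE. Qed.

Lemma has_deriv0_wishart_word y z l : PG y ->
  has_deriv0 (fun t => wishart_word (y + t *: z) l)
    (- \sum_(0 <= i < size l) wishart_word y (insert_at i z l)).
Proof.
move=> [_ py]; rewrite /wishart_word !big_split/= !opprD.
apply: has_deriv0D.
  apply: has_deriv0D.
    rewrite exchange_big/= -sumrN; apply: has_deriv0_sum => i _.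
    rewrite -mulr_sumr -mulrN; apply: has_deriv0Ml.
    apply: has_deriv0_trace_word; first exact: psubmx_affine.
    by apply/posdef_unit/posdef_psubmx.
  rewrite -mulr_sumr -mulrN; apply: has_deriv0Ml.
  by apply: has_deriv0_trace_word => //; exact: posdef_unit.
rewrite exchange_big/= -sumrN; apply: has_deriv0_sum => i _.
rewrite -mulr_sumr -mulrN; apply: has_deriv0Ml.
apply: has_deriv0_trace_word; first exact: psubmx_affine.
by apply/posdef_unit/posdef_psubmx.
Qed.

Lemma log_normE y : ZG y -> log_norm M s y =
  \sum_(1 <= i < M.+1) (vcoord s i - vcoord s i.+1) * ln (\det (psubmx (vint 1 i) y))
  + vcoord s M.+1 * ln (\det y)
  + \sum_(M.+2 <= i < k.+2) (vcoord s i - vcoord s i.-1) *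
      ln (\det (psubmx (vint i k.+1) y)).
Proof.
move=> Zy; rewrite /log_norm /log_laplace det_ZG//; congr (_ + _ + _).
  rewrite [RHS]big_add1; apply: eq_big_nat => i /andP[_ iM].
  by rewrite det_psubmx_vint// ltnS (leq_trans (ltnW iM)).
rewrite [RHS]big_add1; apply: eq_big_nat => i /andP[Mi ik].
by rewrite det_psubmx_vint// /shape_seq; case: i Mi ik.
Qed.

(** Jacobi's formula, for each minor of the product. *)
Lemma has_deriv0_log_norm y z : PG y -> ZG z ->
  has_deriv0 (fun t => log_norm M s (y + t *: z)) (wishart_word y [:: z]).
Proof.
move=> [Zy py] Zz.
have -> : (fun t => log_norm M s (y + t *: z)) = fun t =>
  \sum_(1 <= i < M.+1) (vcoord s i - vcoord s i.+1) *
     ln (\det (psubmx (vint 1 i) (y + t *: z)))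
  + vcoord s M.+1 * ln (\det (y + t *: z))
  + \sum_(M.+2 <= i < k.+2) (vcoord s i - vcoord s i.-1) *
      ln (\det (psubmx (vint i k.+1) (y + t *: z))).
  by apply/funext => t; rewrite log_normE// -[y]scale1r; exact: ZG_lincomb.
have sub (I : {set 'I_k.+1}) : has_deriv0 (fun t => ln (\det (psubmx I (y + t *: z))))
    (trace_word (psubmx I) y [:: z]).
  apply: has_deriv0_ln_det; first exact: psubmx_affine.
  by apply/posdef_det_gt0/posdef_psubmx.
apply: has_deriv0D.
  apply: has_deriv0D; first by apply: has_deriv0_sum => i _; exact: has_deriv0Ml.
  by apply: has_deriv0Ml; apply: has_deriv0_ln_det => //; exact: posdef_det_gt0.
by apply: has_deriv0_sum => i _; exact: has_deriv0Ml.
Qed.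

(** Differentiating in a new direction z_0 either hits the exponential, which
    creates the cycle (z_0), or a factor attached to a cycle, which inserts z_0 in this
    cycle at all positions. By cycle_sum_rec this gives the sum over permutations of
    N + 1 points. *)
Lemma has_deriv0_moment_formula N (c : R) (z : 'I_N.+1 -> 'M[R]_k.+1) y :
  PG y -> (forall j, ZG (z j)) ->
  has_deriv0 (fun t => expR (c - log_norm M s (y + t *: z ord0)) *
     cycle_sum (wishart_word (y + t *: z ord0)) (z \o lift ord0))
   (- (expR (c - log_norm M s y) * cycle_sum (wishart_word y) z)).
Proof.
move=> py Zz; have y0 : y + 0 *: z ord0 = y by rewrite scale0r addr0.
have H1 : has_deriv0 (fun t => expR (c - log_norm M s (y + t *: z ord0)))
    (- wishart_word y [:: z ord0] * expR (c - log_norm M s y)).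
  have := has_deriv0_expR (has_deriv0D (has_deriv0_cst c)
    (has_deriv0N (has_deriv0_log_norm py (Zz ord0)))).
  by rewrite y0 add0r.
have H2 := @has_deriv0_sum _ _ (index_enum 'S_N) xpredT _ _ (fun p _ =>
  @has_deriv0_prod _ _ (fun c => c \in porbits p)
   (fun c t => cycle_value (wishart_word (y + t *: z ord0)) (z \o lift ord0) p c) _
   (fun c _ => @has_deriv0_wishart_word y (z ord0) _ py)).
have := has_deriv0M H1 H2; congr has_deriv0.
rewrite !y0 (cycle_sum_rec (wishart_word_rot1 y)) mulr_sumr mulr_sumr -big_split/=.
rewrite mulr_sumr -sumrN; apply: eq_bigr => p _.
under [X in _ + _ * X]eq_bigr do rewrite size_map mulNr.
by rewrite sumrN; ring.
Qed.

End wishart_functional.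

(** * Moments *)

Section moments.
Context {R : realType} {k : nat}.
Context d (Omega : measurableType d) (P : probability Omega R).
Variables (X : {RV P >-> IG R k.+1}) (M : nat) (s : 'I_k.+1 -> R).
Hypothesis hXQ : forall w, QG (X w).
Hypothesis Mk : (M <= k)%N.
Variable y0 : 'M[R]_k.+1.
Hypothesis py0 : PG y0.
Hypothesis laplace : forall y, PG y ->
  (\int[P]_w (expR (- pairing (X w) (y - y0)))%:E =
   (expR (log_norm M s y0 - log_norm M s y))%:E)%E.

Local Notation W z w := (pairing (X w) z).

Lemma pairing_lincomb (eta : IG R k.+1) (c e : R) (y z : 'M[R]_k.+1) :
  pairing eta (c *: y + e *: z) = c * pairing eta y + e * pairing eta z.
Proof.
rewrite /pairing !mulr_sumr -big_split/=; apply: eq_bigr => i _.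
rewrite !mulr_sumr -big_split/=; apply: eq_bigr => j _.
by rewrite !mxE; ring.
Qed.

Lemma pairingB (eta : IG R k.+1) (y z : 'M[R]_k.+1) :
  pairing eta (y - z) = pairing eta y - pairing eta z.
Proof.
have := pairing_lincomb eta 1 (-1) y z.
by rewrite scale1r scaleN1r mul1r mulN1r.
Qed.

Lemma PG_pairing_ge0 y w : PG y -> 0 <= W y w.
Proof.
move=> py; have [Zy _] := py; rewrite pairingE//.
by apply: lin_pairing_ge0; [exact: PG_positive_minors|exact/QG_in_dual_cone].
Qed.

Lemma pairing_bound y z : PG y -> ZG z ->
  exists2 c, 0 < c & (PG (c *: y - z) /\ PG (c *: y + z)) /\
    forall w, `|W z w| <= c * W y w.
Proof.
move=> py Zz; have [c c0 [p1 p2]] := PG_absorbs py Zz; exists c => //; split=> // w.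
have := PG_pairing_ge0 w p1; have := PG_pairing_ge0 w p2.
rewrite -[z in _ + z]scale1r -scaleN1r !pairing_lincomb mul1r mulN1r => H1 H2.
by rewrite ler_norml; lra.
Qed.

(** A single term of the exponential series. *)
Lemma expr_le_expR (n : nat) (e x : R) : 0 < e -> 0 <= x ->
  x ^+ n <= n`!%:R / e ^+ n * expR (e * x).
Proof.
move=> e0 x0; have ex0 : 0 <= e * x by rewrite mulr_ge0// ltW.
rewrite mulrAC ler_pdivlMr ?exprn_gt0// mulrC -exprMn.
case: n => [|n]; first by rewrite expr0 fact0 mul1r -expR0 ler_expR.
have := expR_ge1Dxn n ex0; set f := _`!%:R => H.
have f0 : 0 < f by rewrite ltr0n fact_gt0.
rewrite -ler_pdivrMl// mulrC; apply: le_trans H.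
by rewrite lerDr.
Qed.

Definition moment_integrand N (z : 'I_N -> 'M[R]_k.+1) y w : R :=
  (\prod_(j < N) W (z j) w) * expR (- W (y - y0) w).

Lemma measurable_pairing_rv z : ZG z -> measurable_fun setT (fun w => W z w).
Proof. by move=> Zz; apply: (measurableT_comp (measurable_pairing Zz)). Qed.

Lemma measurable_moment_integrand N (z : 'I_N -> 'M[R]_k.+1) y :
  (forall j, ZG (z j)) -> ZG y -> measurable_fun setT (moment_integrand z y).
Proof.
move=> Zz Zy; apply: measurable_funM.
  by apply: measurable_prod => j _; exact: measurable_pairing_rv.
apply: measurableT_comp => //; apply: measurableT_comp => //; apply: measurable_pairing_rv.
by rewrite -[y]scale1r -scaleN1r; apply: ZG_lincomb => //; case: py0.
Qed.

Lemma integrable_expR_pairing y (c : R) : PG y ->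
  P.-integrable setT (EFin \o fun w => c * expR (- W (y - y0) w)).
Proof.
move=> py.
have me : measurable_fun setT (fun w => expR (- W (y - y0) w)).
  apply: measurableT_comp => //; apply: measurableT_comp => //; apply: measurable_pairing_rv.
  by rewrite -[y]scale1r -scaleN1r; apply: ZG_lincomb; [case: py|case: py0].
have ie : P.-integrable setT (EFin \o fun w => expR (- W (y - y0) w)).
  apply/integrableP; split; first exact/measurable_EFinP.
  under eq_integral => w _ do rewrite /= ger0_norm ?expR_ge0//.
  by rewrite laplace// ltry.
have := integrableZl measurableT c ie.
by congr (P.-integrable _ _).
Qed.

(** Each factor is bounded by a multiple of <X, y>. *)
Lemma moment_bound N (z : 'I_N -> 'M[R]_k.+1) y : (forall j, ZG (z j)) -> PG y ->
  exists2 C, 0 <= C & forall w, `|\prod_(j < N) W (z j) w| <= C * W y w ^+ N.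
Proof.
move=> Zz py.
pose c j := sval (cid2 (pairing_bound py (Zz j))).
have c0 j : 0 < c j by rewrite /c; case: cid2.
have cW j w : `|W (z j) w| <= c j * W y w by rewrite /c; case: cid2 => /= x _ [].
exists (\prod_j c j); first by apply: prodr_ge0 => j _; exact: ltW.
move=> w; rewrite normr_prod -[X in W y w ^+ X]card_ord -prodr_const -big_split/=.
by apply: ler_prod => j _; rewrite normr_ge0 cW.
Qed.

(** The power <X, y>^N is bounded by a multiple of exp(<X, y> / 2), and y / 2 is
    still in P_G, where the Laplace transform is finite. *)
Lemma moment_integrable N (z : 'I_N -> 'M[R]_k.+1) y : (forall j, ZG (z j)) -> PG y ->
  P.-integrable setT (EFin \o moment_integrand z y).
Proof.
move=> Zz py; have [C C0 HC] := moment_bound Zz py.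
have p2 : PG (0 *: y + 2^-1 *: y) by apply: PG_lincomb; rewrite ?lexx ?invr_gt0.
rewrite scale0r add0r in p2.
apply: (le_integrable measurableT _ _ (integrable_expR_pairing
   (C * (N`!%:R / 2^-1 ^+ N)) p2)).
  by apply/measurable_EFinP; apply: measurable_moment_integrand => //; case: py.
move=> w _ /=; rewrite lee_fin normrM [`|expR _|]ger0_norm ?expR_ge0//.
rewrite [leRHS]ger0_norm; last by rewrite !mulr_ge0 ?expR_ge0.
have Wy := PG_pairing_ge0 w py.
have e2 : 0 < 2^-1 :> R by rewrite invr_gt0.
apply: (le_trans (ler_wpM2r (expR_ge0 _) (HC w))).
apply: (le_trans (ler_wpM2r (expR_ge0 _) (ler_wpM2l C0 (expr_le_expR N e2 Wy)))).
rewrite -!mulrA ler_wpM2l// ler_wpM2l// -expRD ler_wpM2l// ler_expR !pairingB.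
have -> : W (2^-1 *: y) w = 2^-1 * W y w.
  by have := pairing_lincomb (X w) 2^-1 0 y 0; rewrite scale0r addr0 mul0r addr0.
lra.
Qed.

Lemma is_derive_expR_affine (A b c x : R) :
  is_derive x (1 : R) (fun t => A * expR (b + t * c)) (A * (c * expR (b + x * c))).
Proof.
have H1 : is_derive x (1 : R) (fun t => b + t * c) c.
  have := is_deriveD (is_derive_cst b x (1 : R))
    (is_deriveM (is_derive_id x (1 : R)) (is_derive_cst c x (1 : R))).
  by rewrite add0r scaler0 add0r /cst /= => H; apply: is_derive_eq; rewrite -[c *: 1]mulrC mul1r.
have H2 := @is_derive1_comp R expR (fun t => b + t * c) x _ _ (is_derive_expR _) H1.
have := is_deriveZ A H2.
by rewrite [expR _ * c]mulrC.
Qed.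

Section derivative_step.
Variables (N : nat) (z : 'I_N.+1 -> 'M[R]_k.+1) (y : 'M[R]_k.+1).
Hypotheses (Zz : forall j, ZG (z j)) (py : PG y).

Let z' := z \o lift ord0.
Let f (t : R) w := moment_integrand z' (y + t *: z ord0) w.

Lemma moment_integrand_affine t w : f t w =
  (\prod_(j < N) W (z' j) w) * expR (- W (y - y0) w + t * - W (z ord0) w).
Proof.
rewrite /f /moment_integrand; congr (_ * expR _); rewrite !pairingB.
by have := pairing_lincomb (X w) 1 t y (z ord0); rewrite scale1r => ->; ring.
Qed.

Lemma derive_moment_integrand t w : is_derive t (1 : R) (f ^~ w)
  (- (W (z ord0) w * \prod_(j < N) W (z' j) w *
      expR (- W (y - y0) w + t * - W (z ord0) w))).
Proof.
have -> : f ^~ w = fun t => (\prod_(j < N) W (z' j) w) *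
    expR (- W (y - y0) w + t * - W (z ord0) w).
  by apply/funext => x; exact: moment_integrand_affine.
apply: is_derive_eq (is_derive_expR_affine _ _ _ _) _.
ring.
Qed.

Lemma PG_line (c t : R) : 0 < c -> PG (c *: y - z ord0) -> PG (c *: y + z ord0) ->
  `|t| * c < 1 -> PG (y + t *: z ord0).
Proof.
move=> c0 p1 p2 tc.
have d0 : 0 < 1 - `|t| * c by rewrite subr_gt0.
have [t0|t0] := leP 0 t.
  have := PG_lincomb p2 py t0 d0; rewrite ger0_norm//; congr PG.
  rewrite scalerDr scalerA scalerBl scale1r addrC addrA; congr (_ + _).
  by rewrite subrK.
have t0' : 0 <= - t by rewrite oppr_ge0 ltW.
have := PG_lincomb p1 py t0' d0; rewrite ltr0_norm//; congr PG.
rewrite scalerBr scalerA scaleNr opprK scalerBl scale1r addrC addrA; congr (_ + _).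
by rewrite subrK.
Qed.

(** Differentiation under the integral sign. On a neighbourhood of 0 where
    |t <X, z_0>| <= <X, y> / 4, the derivative in t is bounded by a multiple of
    exp(- <X, y / 2 - y0>), which is integrable. *)
Lemma moment_derivative :
  has_deriv0 (fun t => (\int[P]_w f t w)%R) (- (\int[P]_w moment_integrand z y w)%R).
Proof.
have [c c0 [[p1 p2] Wz]] := pairing_bound py (Zz ord0).
have [C C0 HC] := moment_bound (z := z') (fun j => Zz _) py.
(* for |t| < dl the perturbation t <X, z_0> stays below <X, y> / 4 *)
pose dl := (4 * c)^-1.
have dl0 : 0 < dl by rewrite invr_gt0 mulr_gt0.
have dlc t : t \in `]- dl, dl[ -> `|t| * c < 4^-1.
  rewrite in_itv/= => tdl; rewrite -ltr_pdivlMr//.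
  by rewrite -invfM ltr_norml.
(* a power <X, y>^(N + 1) is traded for another exp(<X, y> / 4) *)
pose K := c * C * (N.+1`!%:R / 4^-1 ^+ N.+1).
have K0 : 0 <= K.
  rewrite /K !mulr_ge0// ?invr_ge0 ?exprn_ge0//; exact: ltW.
pose G w := K * expR (- W (2^-1 *: y - y0) w).
have p2' : PG (0 *: y + 2^-1 *: y) by apply: PG_lincomb; rewrite ?lexx ?invr_gt0.
rewrite scale0r add0r in p2'.
have intf x : (`]- dl, dl[%classic : set R) x -> P.-integrable setT (EFin \o f x).
  move=> /= xdl; apply: moment_integrable => [j|]; first exact: Zz.
  apply: (PG_line c0 p1 p2); apply: (lt_trans (dlc _ xdl)).
  by rewrite invf_lt1// ltr1n.
have derf x w : (`]- dl, dl[%classic : set R) x -> setT w -> derivable (f ^~ w) x 1.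
  by move=> _ _; exact: (@ex_derive _ _ _ _ _ _ _ (derive_moment_integrand x w)).
have G0 w : 0 <= G w by rewrite mulr_ge0// expR_ge0.
have intG : P.-integrable setT (EFin \o G) by exact: integrable_expR_pairing.
have partialE x w : partial1of2 f x w = - (W (z ord0) w * \prod_(j < N) W (z' j) w *
      expR (- W (y - y0) w + x * - W (z ord0) w)).
  by rewrite partial1of2E (@derive_val _ _ _ _ _ _ _ (derive_moment_integrand x w)).
have Gub x w : (`]- dl, dl[%classic : set R) x -> setT w -> `|partial1of2 f x w| <= G w.
  move=> /= xdl _; rewrite partialE normrN !normrM [`|expR _|]ger0_norm ?expR_ge0//.
  have Wy := PG_pairing_ge0 w py.
  have e4 : 0 < 4^-1 :> R by rewrite invr_gt0.
  have bound1 : `|W (z ord0) w| * `|\prod_(j < N) W (z' j) w| <=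
      K * expR (4^-1 * W y w).
    apply: (le_trans (ler_pM _ _ (Wz w) (HC w))) => //.
    rewrite [leLHS](_ : _ = c * C * W y w ^+ N.+1); last by rewrite exprS; ring.
    by rewrite /K -[leRHS]mulrA ler_wpM2l ?expr_le_expR// mulr_ge0// ltW.
  apply: (le_trans (ler_wpM2r (expR_ge0 _) bound1)).
  rewrite /G -mulrA ler_wpM2l// -expRD ler_expR !pairingB.
  have -> : W (2^-1 *: y) w = 2^-1 * W y w.
    by have := pairing_lincomb (X w) 2^-1 0 y 0; rewrite scale0r addr0 mul0r addr0.
  have xW : `|x * W (z ord0) w| <= 4^-1 * W y w.
    rewrite normrM (le_trans (ler_wpM2l (normr_ge0 _) (Wz w)))// mulrA.
    by rewrite ler_wpM2r// ltW// dlc.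
  by move: xW; rewrite ler_norml mulrN => /andP[]; lra.
have I0 : (`]- dl, dl[%classic : set R) 0 by rewrite /= in_itv/= oppr_lt0 dl0.
have der := derivable_under_integral measurableT I0 intf derf G0 intG Gub.
have val := differentiation_under_integral measurableT I0 intf derf G0 intG Gub.
apply: DeriveDef; first exact: der.
rewrite -derive1E val -mulN1r -RintegralZl//; last exact: moment_integrable.
apply: eq_Rintegral => w _; rewrite partialE mul0r addr0 mulN1r /moment_integrand.
by rewrite big_ord_recl.
Qed.

End derivative_step.

(** Induction on N: both sides for N + 1 are minus the derivative, in the direction
    of the new matrix, of the two sides for N. *)
Theorem moment_formula N (z : 'I_N -> 'M[R]_k.+1) y : (forall j, ZG (z j)) -> PG y ->
  (\int[P]_w (moment_integrand z y w)%:E =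
   (expR (log_norm M s y0 - log_norm M s y) * cycle_sum (wishart_word M s y) z)%:E)%E.
Proof.
elim: N z y => [|N IH] z y Zz py.
  have -> : cycle_sum (wishart_word M s y) z = 1.
    rewrite /cycle_sum (big_pred1 1%g) => [|p]; last first.
      by rewrite /=; apply/esym/eqP/permP => -[].
    by rewrite big1// => c /porbitsP[[]].
  rewrite mulr1 -laplace//; apply: eq_integral => w _.
  by rewrite /moment_integrand big_ord0 mul1r.
have int1 := moment_integrable Zz py.
have H1 := moment_derivative Zz py.
have H2 := has_deriv0_moment_formula s Mk (log_norm M s y0) py Zz.
have [c c0 [[p1 p2] _]] := pairing_bound py (Zz ord0).
have E := has_deriv0_unique _ H1 H2.
rewrite -[LHS]fineK ?integrable_fin_num//; congr EFin.
apply: oppr_inj; apply: E.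
near=> t.
rewrite /Rintegral IH//=.
apply: (PG_line py c0 p1 p2).
rewrite -ltr_pdivlMr//; near: t.
apply/nbhs_ballP; exists (1 / c); first by rewrite /= divr_gt0.
by move=> x; rewrite /ball/= sub0r normrN.
Unshelve. all: by end_near. Qed.

End moments.

Theorem theorem6 (R : realType) (n M : nat) (hM : (1 <= M <= n)%N)
    (s : 'I_n -> R)
    (hs : forall i : nat, (1 <= i <= n)%N -> i != M -> 1 / 2 < vcoord s i)
    (hsM : 0 < vcoord s M)
    (y : 'M[R]_n) (hy : PG y)
    (d : measure_display) (Omega : measurableType d)
    (P : probability Omega R)
    (X : {RV P >-> IG R n})
    (hXQ : forall w : Omega, QG (X w))
    (hX : forall A : set (IG R n), measurable A ->
      distribution P X A = wishart M s y A)
    (N : nat) (hN : (1 <= N)%N)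
    (z : 'I_N -> 'M[R]_n) (hz : forall j : 'I_N, ZG (z j)) :
  'E_P[fun w : Omega => (\prod_(j < N) pairing (X w) (z j))%R]%E =
  (\sum_(p : 'S_N) \prod_(c in porbits p)
     (\sum_(1 <= i < M) (vcoord s i - vcoord s i.+1) *
        tr_cycle p c (fun j : 'I_N =>
          invmx (psubmx (vint 1 i) y) *m psubmx (vint 1 i) (z j))
      + vcoord s M * tr_cycle p c (fun j : 'I_N => invmx y *m z j)
      + \sum_(M.+1 <= i < n.+1) (vcoord s i - vcoord s i.-1) *
        tr_cycle p c (fun j : 'I_N =>
          invmx (psubmx (vint i n) y) *m psubmx (vint i n) (z j))))%:E.
Proof.
case: n hM s hs hsM y hy X hXQ hX z hz => [|k] hM s hs hsM y py X hXQ hX z Zz.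
  by move: hM => /andP[] /leq_trans /[apply].
case: M hM hs hsM hX => [//|M] /andP[_ Mk] hs hsM hX.
rewrite ltnS in Mk.
have laplace := wishart_laplace_transform Mk py hX.
have := moment_formula hXQ Mk py laplace Zz py.
rewrite subrr expR0 mul1r => E.
rewrite unlock; transitivity (\int[P]_w (moment_integrand X y z y w)%:E)%E.
  apply: eq_integral => w _; congr EFin.
  by rewrite /moment_integrand pairingB subrr oppr0 expR0 mulr1.
rewrite E; congr EFin; apply: eq_bigr => p _; apply: eq_bigr => c _.
rewrite /cycle_value /wishart_word /trace_word /word_mx.
congr (_ + _ + _).
- by apply: eq_bigr => i _; rewrite /tr_cycle big_map.
- by rewrite /tr_cycle big_map.
- by apply: eq_bigr => i _; rewrite /tr_cycle big_map.
Qed.
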